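(* Let $m,n$ be positive integers and let $L$ be a broken line in $M_{m,n}(\mathbb{Z}_+)$. All members of the family $\mathcal{V}_L$ of quantum minors in $\mathcal{O}_q(M(m,n))$ $q$-commute with each other.
   Context: $K=\mathbb{Q}(q)$. $\mathcal{O}_q(M(m,n))$ is the associative $K$-algebra generated by $Z_{i,j}$ ($1\le i\le m$, $1\le j\le n$) with relations $Z_{ij}Z_{ik}=q^2Z_{ik}Z_{ij}$ if $j<k$; $Z_{ij}Z_{kj}=q^2Z_{kj}Z_{ij}$ if $i<k$; $Z_{ij}Z_{st}=Z_{st}Z_{ij}$ if $i>s,\ j<t$; $Z_{ij}Z_{st}=Z_{st}Z_{ij}+(q^2-q^{-2})Z_{it}Z_{sj}$ if $i<s,\ j<t$. For $I=\{i_1<\dots<i_r\}$ (rows), $J=\{j_1<\dots<j_r\}$ (columns), $\xi^I_J=\sum_{\sigma\in S_r}(-q^2)^{\ell(\sigma)}Z_{i_1,j_{\sigma(1)}}\cdots Z_{i_r,j_{\sigma(r)}}$ is a quantum minor, solid if $I,J$ consist of consecutive integers. Elements $x,y$ $q$-commute if $xy=q^{2p}yx$ for some integer $p$. A broken line $L$ in $M_{m,n}(\mathbb{Z}_+)$ is a lattice path from $(1,n)$ to $(m,1)$ each of whose unit steps lowers the column number by 1 or raises the row number by 1; it is identified with its set of lattice points. Every diagonal $\{i-j=\text{const}\}$ of the $m\times n$ rectangle meets $L$ exactly once. $S_L$ (points above $L$): those $(i,j)\notin L$ with $(i+t,j+t)\in L$ for some $t>0$; $T_L$ (points below $L$): those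 $(i,j)\notin L$ with $(i-t,j-t)\in L$ for some $t>0$. $\mathcal{V}_L$ is the family of $mn$ quantum minors indexed by points: for $(i,j)\in T_L\cup L$, the biggest solid quantum minor with bottom right corner $(i,j)$ completely contained in $T_L\cup L$; for $(i,j)\in S_L$, the biggest solid quantum minor (inside the $m\times n$ rectangle) with upper left corner $(i,j)$. *)

(* Defs.v *)
From HB Require Import structures.
From mathcomp Require Import all_boot all_order all_algebra all_fingroup.
From mathcomp Require Import fraction generic_quotient ring_quotient.
From mathcomp Require Import finmap boolp.
From mathcomp Require Import monalg.

Set Implicit Arguments.
Unset Strict Implicit.
Unset Printing Implicit Defensive.

Import GRing.Theory.
Local Open Scope ring_scope.
Local Open Scope quotient_scope.

Record ideal2 (K : fieldType) (A : algType K) := Ideal2 {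
  ideal2_pred :> A -> Prop;
  ideal2_0 : ideal2_pred 0;
  ideal2_add : forall x y, ideal2_pred x -> ideal2_pred y -> ideal2_pred (x + y);
  ideal2_mul : forall a x b, ideal2_pred x -> ideal2_pred (a * x * b);
  ideal2_proper : ~ ideal2_pred 1
}.

Section QuotientAlgebra.
Variables (K : fieldType) (A : algType K) (I : ideal2 A).

Lemma ideal2_mull a x : I x -> I (a * x).
Proof. by move=> Ix; rewrite -[a * x]mulr1; apply: ideal2_mul. Qed.

Lemma ideal2_mulr x b : I x -> I (x * b).
Proof. by move=> Ix; rewrite -[x]mul1r; apply: ideal2_mul. Qed.

Lemma ideal2Z c x : I x -> I (c *: x).
Proof. by move=> Ix; rewrite -[x]mul1r scalerAl; apply: ideal2_mull. Qed.

Definition ideal2b (x : A) : bool := `[< I x >].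

Lemma ideal2b_zmod_closed : zmod_closed ideal2b.
Proof.
split=> [|x y /asboolP Ix /asboolP Iy]; apply/asboolP; first exact: ideal2_0.
by apply: ideal2_add => //; rewrite -scaleN1r; apply: ideal2Z.
Qed.

HB.instance Definition _ :=
  GRing.isZmodClosed.Build A ideal2b ideal2b_zmod_closed.

Definition quotalg := Quotient.quot (GRing.ZmodClosed.clone _ ideal2b _).
Local Notation Q := quotalg.

HB.instance Definition _ := GRing.Zmodule.on Q.
HB.instance Definition _ := Quotient.on Q.

Definition piq (x : A) : Q := \pi_Q x.

Lemma piq_eq x y : reflect (I (x - y)) (piq x == piq y).
Proof. by rewrite /piq -Quotient.idealrBE; apply: asboolP. Qed.

Lemma piq_repr (x : Q) : piq (repr x) = x.
Proof. exact: reprK. Qed.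

Lemma piqD x y : piq (x + y) = piq x + piq y.
Proof. by rewrite /piq piE. Qed.

Lemma ideal2_repr x : I (repr (piq x) - x).
Proof. by apply/piq_eq; rewrite piq_repr. Qed.

Definition oneq : Q := piq 1.
Definition mulq (x y : Q) : Q := piq (repr x * repr y).
Definition scaleq (c : K) (x : Q) : Q := piq (c *: repr x).

Lemma mulqE x y : mulq (piq x) (piq y) = piq (x * y).
Proof.
apply/eqP/piq_eq; set x' := repr _; set y' := repr _.
have -> : x' * y' - x * y = (x' - x) * y' + x * (y' - y).
  by rewrite mulrBl mulrBr addrA subrK.
by apply: ideal2_add; [apply: ideal2_mulr | apply: ideal2_mull];
  apply: ideal2_repr.
Qed.

Lemma scaleqE c x : scaleq c (piq x) = piq (c *: x).
Proof. by apply/eqP/piq_eq; rewrite -scalerBr; apply/ideal2Z/ideal2_repr. Qed.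

Lemma mulqA : associative mulq.
Proof.
move=> x y z; rewrite -[x]piq_repr -[y]piq_repr -[z]piq_repr.
by rewrite !mulqE mulrA.
Qed.

Lemma mul1q : left_id oneq mulq.
Proof. by move=> x; rewrite -[x]piq_repr mulqE mul1r. Qed.

Lemma mulq1 : right_id oneq mulq.
Proof. by move=> x; rewrite -[x]piq_repr mulqE mulr1. Qed.

Lemma mulqDl : left_distributive mulq +%R.
Proof.
move=> x y z; rewrite -[x]piq_repr -[y]piq_repr -[z]piq_repr.
by rewrite -piqD !mulqE -piqD mulrDl.
Qed.

Lemma mulqDr : right_distributive mulq +%R.
Proof.
move=> x y z; rewrite -[x]piq_repr -[y]piq_repr -[z]piq_repr.
by rewrite -piqD !mulqE -piqD mulrDr.
Qed.

Lemma oneq_neq0 : oneq != 0.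
Proof.
have -> : 0 = piq 0 by rewrite /piq piE.
by apply/piq_eq; rewrite subr0; apply: ideal2_proper.
Qed.

HB.instance Definition _ := GRing.Zmodule_isNzRing.Build Q
  mulqA mul1q mulq1 mulqDl mulqDr oneq_neq0.

Lemma scaleqA a b x : scaleq a (scaleq b x) = scaleq (a * b) x.
Proof. by rewrite -[x]piq_repr !scaleqE scalerA. Qed.

Lemma scale1q : left_id 1 scaleq.
Proof. by move=> x; rewrite -[x]piq_repr scaleqE scale1r. Qed.

Lemma scaleqDr : right_distributive scaleq +%R.
Proof.
move=> c x y; rewrite -[x]piq_repr -[y]piq_repr.
by rewrite -piqD !scaleqE -piqD scalerDr.
Qed.

Lemma scaleqDl x : {morph scaleq^~ x : a b / a + b}.
Proof. by move=> a b /=; rewrite -[x]piq_repr !scaleqE -piqD scalerDl. Qed.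

HB.instance Definition _ := GRing.Zmodule_isLmodule.Build K Q
  scaleqA scale1q scaleqDr scaleqDl.

Lemma piqM x y : piq (x * y) = piq x * piq y.
Proof. by rewrite -mulqE. Qed.

Lemma piqZ c x : piq (c *: x) = c *: piq x.
Proof. by rewrite -scaleqE. Qed.

Lemma scaleqAl c (x y : Q) : c *: (x * y) = (c *: x) * y.
Proof.
by rewrite -[x]piq_repr -[y]piq_repr -piqM -!piqZ -piqM scalerAl.
Qed.

HB.instance Definition _ := GRing.Lmodule_isLalgebra.Build K Q scaleqAl.

Lemma scaleqAr c (x y : Q) : c *: (x * y) = x * (c *: y).
Proof.
by rewrite -[x]piq_repr -[y]piq_repr -piqM -!piqZ -piqM scalerAr.
Qed.

HB.instance Definition _ := GRing.Lalgebra_isAlgebra.Build K Q scaleqAr.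

End QuotientAlgebra.

Section FreeAlgebra.
Variables (K : fieldType) (T : choiceType).

Definition freealg := {malg K[{fmonom T}]}.
HB.instance Definition _ := GRing.Lalgebra.on freealg.

Lemma freealg_scalerAr c (x y : freealg) : c *: (x * y) = x * (c *: y).
Proof.
have cC : c%:MP * x = x * c%:MP; last first.
  have -> : c *: (x * y) = c%:MP * (x * y) by exact/esym/mul_malgC.
  have -> : c *: y = c%:MP * y by exact/esym/mul_malgC.
  apply: etrans (mulrA _ _ _) _; apply: etrans (congr1 ( *%R^~ y) cC) _.
  exact: esym (mulrA _ _ _).
rewrite !malgM_def fgmulUg fgmulgU; apply: eq_bigr => k _.
by rewrite mul1m mulm1 mulrC.
Qed.

HB.instance Definition _ :=
  GRing.Lalgebra_isAlgebra.Build K freealg freealg_scalerAr.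

Definition freegen (t : T) : freealg := << fmu t >>.

(** The augmentation, sending every symbol to 0. *)
Definition augm (x : freealg) : K := x@_(mone : {fmonom T}).

Lemma augm_gen t : augm (freegen t) = 0.
Proof.
rewrite /augm /freegen mcoeffU1; case: eqP => // /(congr1 (@fmonom_val _)).
by rewrite fmuE fm1.
Qed.

Lemma augmD x y : augm (x + y) = augm x + augm y.
Proof. exact: mcoeffD. Qed.

Lemma augmZ c x : augm (c *: x) = c * augm x.
Proof. exact: mcoeffZ. Qed.

Lemma augmM x y : augm (x * y) = augm x * augm y.
Proof. exact: (rmorphM (mcoeff mone)). Qed.

Lemma augm1 : augm 1 = 1.
Proof. exact: (rmorph1 (mcoeff mone)). Qed.

End FreeAlgebra.

(** The ground field [K] and the parameter [q] are instantiated by Q(q) and its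
    generator at the end of this file.  Rows and columns are numbered from 0,
    i.e. by ['I_m] and ['I_n]. *)

Section Relations.
Variables (K : fieldType) (q : K) (A : algType K) (m n : nat).
Variable z : 'I_m -> 'I_n -> A.

(** The defining relations, each written as left-hand side minus right-hand
    side. *)
Inductive relator : A -> Prop :=
| Rel_row i (j k : 'I_n) of (j < k)%N :
    relator (z i j * z i k - q ^+ 2 *: (z i k * z i j))
| Rel_col (i k : 'I_m) j of (i < k)%N :
    relator (z i j * z k j - q ^+ 2 *: (z k j * z i j))
| Rel_anti (i s : 'I_m) (j t : 'I_n) of (s < i)%N & (j < t)%N :
    relator (z i j * z s t - z s t * z i j)
| Rel_diag (i s : 'I_m) (j t : 'I_n) of (i < s)%N & (j < t)%N :
    relator (z i j * z s t -
      (z s t * z i j + (q ^+ 2 - q ^- 2) *: (z i t * z s j))).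

(** The two-sided ideal generated by the relators. *)
Inductive rel_ideal : A -> Prop :=
| Rel_ideal_gen r of relator r : rel_ideal r
| Rel_ideal_0 : rel_ideal 0
| Rel_ideal_add x y of rel_ideal x & rel_ideal y : rel_ideal (x + y)
| Rel_ideal_mul a x b of rel_ideal x : rel_ideal (a * x * b).

Lemma rel_ideal_ker (e : A -> K) :
    (forall x y, e (x + y) = e x + e y) -> (forall c x, e (c *: x) = c * e x) ->
    (forall x y, e (x * y) = e x * e y) -> (forall i j, e (z i j) = 0) ->
  forall x, rel_ideal x -> e x = 0.
Proof.
move=> eD eZ eM ez.
have e0 : e 0 = 0 by rewrite -(scale0r 0) eZ mul0r.
have eN x : e (- x) = - e x by rewrite -scaleN1r eZ mulN1r.
move=> x; elim=> [r [] *||a b _ a0 _ b0|a b c _ b0] //.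
- by rewrite eD eN eZ !eM !ez !mulr0 subr0.
- by rewrite eD eN eZ !eM !ez !mulr0 subr0.
- by rewrite eD eN !eM !ez !mulr0 subr0.
- by rewrite eD eN eD eZ !eM !ez !mulr0 addr0 subr0.
- by rewrite eD a0 b0 addr0.
by rewrite !eM b0 mulr0 mul0r.
Qed.

End Relations.

Section QuantumMatrices.
Variables (K : fieldType) (q : K) (m n : nat).

Definition freeZ (i : 'I_m) (j : 'I_n) : freealg K ('I_m * 'I_n)%type :=
  freegen K (i, j).

Lemma freeZ_ideal_proper : ~ rel_ideal q freeZ 1.
Proof.
move=> /(rel_ideal_ker (@augmD _ _) (@augmZ _ _) (@augmM _ _)) e1.
have /eqP := e1 (fun i j => augm_gen K (i, j)).
by rewrite augm1 oner_eq0.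
Qed.

Definition Oq_ideal : ideal2 (freealg K ('I_m * 'I_n)%type) :=
  Ideal2 (@Rel_ideal_0 _ q _ _ _ freeZ) (@Rel_ideal_add _ q _ _ _ freeZ)
    (@Rel_ideal_mul _ q _ _ _ freeZ) freeZ_ideal_proper.

Definition Oq := quotalg Oq_ideal.
HB.instance Definition _ := GRing.Algebra.on Oq.

Definition Z (i : 'I_m) (j : 'I_n) : Oq := piq Oq_ideal (freeZ i j).

Lemma Z_rel x y : relator q freeZ (x - y) -> piq Oq_ideal x = piq Oq_ideal y.
Proof. by move=> r; apply/eqP/piq_eq/Rel_ideal_gen. Qed.

Lemma Z_row i (j k : 'I_n) : (j < k)%N ->
  Z i j * Z i k = q ^+ 2 *: (Z i k * Z i j).
Proof. by move=> jk; rewrite -!piqM -piqZ; apply/Z_rel/Rel_row. Qed.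

Lemma Z_col (i k : 'I_m) j : (i < k)%N ->
  Z i j * Z k j = q ^+ 2 *: (Z k j * Z i j).
Proof. by move=> ik; rewrite -!piqM -piqZ; apply/Z_rel/Rel_col. Qed.

Lemma Z_anti (i s : 'I_m) (j t : 'I_n) : (s < i)%N -> (j < t)%N ->
  Z i j * Z s t = Z s t * Z i j.
Proof. by move=> si jt; rewrite -!piqM; apply/Z_rel/Rel_anti. Qed.

Lemma Z_diag (i s : 'I_m) (j t : 'I_n) : (i < s)%N -> (j < t)%N ->
  Z i j * Z s t = Z s t * Z i j + (q ^+ 2 - q ^- 2) *: (Z i t * Z s j).
Proof. by move=> si jt; rewrite -!piqM -piqZ -piqD; apply/Z_rel/Rel_diag. Qed.

End QuantumMatrices.

Definition qcommute (K : fieldType) (q : K) (A : algType K) (x y : A) : Prop :=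
  exists p : int, x * y = q ^ (2 * p) *: (y * x).

(** The length of a permutation, as its number of inversions. *)
Definition perm_length r (s : 'S_r) : nat :=
  #|[set ij : 'I_r * 'I_r | (ij.1 < ij.2)%N && (s ij.2 < s ij.1)%N]|.

(** [enum I] and [enum_val : 'I_#|J| -> 'I_n] list [I] and [J] in increasing
    order, so the k-th pair of the [zip] is (i_k, j_(s k)).  Only meaningful
    when [#|I| = #|J|]. *)
Definition qminor (K : fieldType) (q : K) m n (I : {set 'I_m}) (J : {set 'I_n}) :
    Oq q m n :=
  \sum_(s : 'S_#|J|) (- q ^+ 2) ^+ perm_length s *:
    \prod_(ij <- zip (enum I) [seq enum_val (s k) | k <- enum 'I_#|J|])
      Z q ij.1 ij.2.

(** Row set, column set. *)
Notation index_pair m n := ({set 'I_m} * {set 'I_n})%type.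

Definition consecutive k (I : {set 'I_k}) : bool :=
  [forall a in I, forall b in I, forall c : 'I_k, (a <= c <= b)%N ==> (c \in I)].

Definition solid m n (X : index_pair m n) : bool :=
  [&& #|X.1| == #|X.2|, consecutive X.1 & consecutive X.2].

Definition has_upper_left m n (x : 'I_m * 'I_n) (X : index_pair m n) : bool :=
  [&& x.1 \in X.1, x.2 \in X.2,
      [forall a in X.1, x.1 <= a]%N & [forall b in X.2, x.2 <= b]%N].

Definition has_bottom_right m n (x : 'I_m * 'I_n) (X : index_pair m n) : bool :=
  [&& x.1 \in X.1, x.2 \in X.2,
      [forall a in X.1, a <= x.1]%N & [forall b in X.2, b <= x.2]%N].

Definition line_step m n (x y : 'I_m * 'I_n) : bool :=
  ((y.1 == x.1) && (x.2 == y.2.+1 :> nat)) ||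
  ((y.1 == x.1.+1 :> nat) && (y.2 == x.2)).

(** From the top right corner (0, n-1) to the bottom left corner (m-1, 0). *)
Definition broken_line m n (L : {set 'I_m * 'I_n}) : Prop :=
  exists (x : 'I_m * 'I_n) (s : seq ('I_m * 'I_n)),
    [/\ x.1 = 0%N :> nat /\ x.2.+1 = n,
        path (@line_step m n) x s,
        (last x s).1.+1 = m /\ (last x s).2 = 0%N :> nat
      & L = [set y in x :: s]].

(** [y = x + (t, t)] *)
Definition diag_shift m n (x : 'I_m * 'I_n) (t : nat) (y : 'I_m * 'I_n) : bool :=
  (y.1 == x.1 + t :> nat)%N && (y.2 == x.2 + t :> nat)%N.

(** Shifts [t >= m] leave the rectangle, so [t : 'I_m] is no restriction. *)
Definition above m n (L : {set 'I_m * 'I_n}) : {set 'I_m * 'I_n} :=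
  [set x | (x \notin L) &&
     [exists t : 'I_m, (0 < t)%N && [exists y in L, diag_shift x t y]]].

Definition below m n (L : {set 'I_m * 'I_n}) : {set 'I_m * 'I_n} :=
  [set x | (x \notin L) &&
     [exists t : 'I_m, (0 < t)%N && [exists y in L, diag_shift y t x]]].

Definition inside m n (A : {set 'I_m * 'I_n}) (X : index_pair m n) : bool :=
  setX X.1 X.2 \subset A.

(** The one-entry minor at [x] is a candidate in the uses below, and a solid
    minor with a given corner is determined by its size. *)
Definition biggest m n (x : 'I_m * 'I_n) (P : pred (index_pair m n)) :
    index_pair m n :=
  [arg max_(X > ([set x.1], [set x.2]) | P X) #|X.1|].

(** For a broken line [L], the points outside [above L] are those of
    [below L :|: L], since each diagonal meets [L]. *)
Definition Vindex m n (L : {set 'I_m * 'I_n}) (x : 'I_m * 'I_n) :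
    index_pair m n :=
  if x \in above L then biggest x [pred X | solid X && has_upper_left x X]
  else biggest x [pred X | [&& solid X, has_bottom_right x X
                             & inside (below L :|: L) X]].

(** The member of V_L indexed by the point [x]. *)
Definition Vfamily (K : fieldType) (q : K) m n (L : {set 'I_m * 'I_n})
    (x : 'I_m * 'I_n) : Oq q m n :=
  qminor q (Vindex L x).1 (Vindex L x).2.

Definition Qq : fieldType := {fraction {poly rat}}.
Definition qvar : Qq := tofrac ('X : {poly rat}).

(* Main.v *)
From HB Require Import structures.
Require Import Defs.
From mathcomp Require Import all_boot all_order all_algebra all_fingroup.
From mathcomp Require Import fraction boolp functions.
From mathcomp Require Import zify ring.

Set Implicit Arguments.
Unset Strict Implicit.
Unset Printing Implicit Defensive.
Import GRing.Theory.
Local Open Scope ring_scope.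

(** Write [I|J] for the quantum minor with rows I and columns J, and p for q^2.
    The theorem has an algebraic and a combinatorial half.

    Algebra ([qminor_qcommute]): [I|J] and [I'|J'] q-commute as soon as every
    element of J \ J' precedes every element of J' \ J, while every element of
    I' \ I precedes every element of I \ I'; empty differences are allowed, so
    nested minors are included.  The reason is the R-matrix.  A product
    z_(i1,j1) ... z_(iN,jN) is a function of a row word w = i1...iN and a
    column word v = j1...jN.  A Hecke type braiding T_t acts on functions of
    words by exchanging the letters t and t+1, up to a correction term where
    the letters stay in place, and the defining relations of quantum matrices
    say exactly that T_t acting on the row word and T_t acting on the column
    word have the same effect on these products ([monz_RTT]).  A quantum minor
    is the value at increasing words of the q-antisymmetrized product
    ([asym_monz]).  Take the product antisymmetrized in two blocks, and push
    one block of columns across the other by a positive braid: by the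
    Yang-Baxter equation the braid commutes with the antisymmetrizers
    ([swapr_asym_left], [swapr_asym_right]), and by the RTT relation it can be
    traded for a braid on the rows ([monz_swap]).  This gives an identity whose
    two sides are sums with leading terms [I|J][I'|J'] and [I'|J'][I|J].

    All other terms vanish.  A correction replaces a letter of one block by a
    smaller one and a letter of the other block by a larger one, so the sum of
    the letters of a block moves strictly in one direction ([swapr_eval],
    [swapl_eval]).  Antisymmetry kills every word with a repeated letter in a
    block ([qskew_repeat]), and among the ways to distribute the letters of J
    and J' over two repetition-free blocks, J itself has the least sum when
    J \ J' precedes J' \ J ([min_weight]); likewise I has the greatest.  Hence
    only the leading terms survive, and their coefficients are powers of p.

    Combinatorics ([Vindex_spec], [anchored_not_NW_SE]): every member of V_L is
    a square submatrix on consecutive rows and columns whose upper left corner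
    either lies on L, or lies strictly above L while the square touches the
    lower or the right side of the rectangle.  Two points of L are never
    strictly northwest-southeast of each other, so neither of two such squares
    lies strictly northwest of the other (both corners compared).  For
    intervals this is all that is needed for the algebraic criterion to apply
    to the two minors, in one order or the other. *)

(** * Braidings on functions of words *)

Lemma fun_addE (U : Type) (V : nmodType) (f g : U -> V) x : (f + g) x = f x + g x.
Proof. by []. Qed.
Lemma fun_oppE (U : Type) (V : zmodType) (f : U -> V) x : (- f) x = - f x.
Proof. by []. Qed.
Lemma fun_scaleE (U : Type) (K : pzRingType) (V : lmodType K) c (f : U -> V) x :
  (c *: f) x = c *: f x.
Proof. by []. Qed.
Definition funE := (fun_addE, fun_oppE, fun_scaleE).

Lemma not_uniq_split (T : eqType) (v : seq T) :
  ~~ uniq v -> exists a v1 v2 v3, v = v1 ++ a :: v2 ++ a :: v3.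
Proof.
elim: v => //= x v IH; rewrite negb_and negbK => /orP[|/IH [a [v1 [v2 [v3 ->]]]]].
  by case/splitPr => v2 v3; exists x, [::], v2, v3.
by exists a, (x :: v1), v2, v3.
Qed.

Section Braid.
Variables (K : fieldType) (p : K) (n : nat).
Hypothesis p0 : p != 0.
Local Notation word := (seq 'I_n).

Section Operators.
Variable V : lmodType K.
Implicit Types (h g : word -> V) (r u v : word) (s t o k l : nat) (a b x y : 'I_n).

(** The Hecke generator T_t, exchanging the letters at places t and t+1 of a
    word.  It is written on functions of words, i.e. dual to tensors, so that no
    sum over words ever occurs; in a composite, the outermost operator is the
    first to act on the word.  The normalization has no correction term when
    the two letters increase, and eigenvalues 1/p and -p.  Words too short to
    have a place t+1 are sent to 0, which makes the Yang-Baxter and commutation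
    relations hold on all words. *)
Fixpoint braid t h (w : word) {struct t} : V :=
  match t, w with
  | 0, a :: b :: r =>
      (if a == b then p^-1 else 1) *: h [:: b, a & r] +
      (if (b < a)%N then p^-1 - p else 0) *: h [:: a, b & r]
  | t'.+1, a :: r => braid t' (fun r' => h (a :: r')) r
  | _, _ => 0
  end.

Lemma braid_is_linear t : linear (braid t).
Proof.
move=> c g h; apply/funext => w; rewrite !funE.
elim: t w g h => [|t IH] [|a r] g h //=; rewrite ?scaler0 ?addr0 //.
  case: r => [|b r]; first by rewrite scaler0 addr0.
  by rewrite !funE !scalerDr !scalerA ![_ * c]mulrC addrACA.
exact: IH.
Qed.
HB.instance Definition _ t :=
  GRing.isLinear.Build K (word -> V) (word -> V) _ (braid t) (braid_is_linear t).

Lemma braid0E h a b r : braid 0 h [:: a, b & r] =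
      (if a == b then p^-1 else 1) *: h [:: b, a & r] +
      (if (b < a)%N then p^-1 - p else 0) *: h [:: a, b & r].
Proof. by []. Qed.

Lemma braidSE t h a r : braid t.+1 h (a :: r) = braid t (fun r' => h (a :: r')) r.
Proof. by []. Qed.

Lemma braid_YB t h :
  braid t (braid t.+1 (braid t h)) = braid t.+1 (braid t (braid t.+1 h)).
Proof.
apply/funext; elim: t h => [|t IH] h [|a r] //; last exact: IH.
case: r => [|b [|c r]] //=; rewrite ?scaler0 ?addr0 //.
rewrite ![b == a]eq_sym ![c == b]eq_sym -!val_eqE /=.
rewrite !scalerDr !scalerA.
(* One case per relative order of the three letters. *)
case: (ltngtP a b) => [ab|ab|/val_inj ab];
  case: (ltngtP b c) => [bc|bc|/val_inj bc];
  case: (ltngtP a c) => [ac|ac|/val_inj ac]; subst=> //; try (exfalso; lia);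
  rewrite ?(scale0r, scale1r, addr0, add0r, mulr0, mul0r, mulr1, mul1r) //.
- by rewrite addrACA.
- by rewrite [_^-1 * (_ - _)]mulrC.
- by rewrite addrACA.
- by rewrite [_^-1 * (_ - _)]mulrC.
- by rewrite [LHS](AC (3*(2*2)) (1*4*3*((2*6)*(5*7)))).
- rewrite [LHS](AC (2*2) (1*3*(2*4))) -[X in _ + X = _]scalerDl.
  by congr (_ + _ + _); rewrite 1?mulrC //; congr (_ *: _); field.
- rewrite [RHS](AC (2*2) (1*3*(2*4))) -[X in _ = _ + X]scalerDl.
  by congr (_ + _ + _); rewrite 1?mulrC //; congr (_ *: _); field.
Qed.

Lemma braid_comm s t h : (s.+1 < t)%N -> braid s (braid t h) = braid t (braid s h).
Proof.
move=> st; apply/funext; elim: s t h st => [|s IH] [|t] h // st [|a r] //; last exact: IH.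
case: t st => [|t] // _; case: r => [|b r] //.
have lin c d f g : braid t (c *: f + d *: g) r = c *: braid t f r + d *: braid t g r.
  by rewrite linearD !linearZ.
exact/esym/lin.
Qed.

(** The quadratic Hecke relation fails on words so short that a braiding sends
    them to 0; it holds on functions that live on words of one length. *)
Definition supp N h := forall r, size r != N -> h r = 0.

Lemma braid_supp N t h : supp N h -> supp N (braid t h).
Proof.
move=> hN r; elim: t N h hN r => [|t IH] N h hN [|a r] //=.
  case: r => [|b r] //= sr; rewrite !hN ?scaler0 ?addr0 //.
case: N hN => [|N] hN sr; last by apply: (IH N) => // r' ?; apply: hN.
have -> : (fun r' => h (a :: r')) = 0 by apply/funext => r'; apply: hN.
by rewrite linear0.
Qed.

Lemma braid_quad N t h : (t.+1 < N)%N -> supp N h ->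
  braid t (braid t h) = h + (p^-1 - p) *: braid t h.
Proof.
move=> tN hN; apply/funext => r; rewrite !funE.
have [sr|sr] := eqVneq (size r) N; last first.
  by rewrite hN // !(braid_supp _ hN) // ?(braid_supp t (braid_supp t hN)) // scaler0 addr0.
move: tN; rewrite -sr; elim: t r h {hN sr} => [|t IH] [|a r] h //; last exact: IH.
case: r => [|b r] // _; rewrite !braid0E.
rewrite !scalerDr !scalerA [b == a]eq_sym -!val_eqE /=.
case: (ltngtP a b) => [ab|ab|/val_inj ab]; subst;
  rewrite ?(scale0r, scale1r, addr0, add0r, mulr0, mul0r, mulr1, mul1r) //.
rewrite -[X in X + _]scale1r -scalerDl; congr (_ *: _).
by field.
Qed.

Lemma braidB t c h g : braid t (h - c *: g) = braid t h - c *: braid t g.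
Proof. by rewrite linearB linearZ. Qed.

Arguments braid : simpl never.

(** * The q-antisymmetrizer *)

(** 1 - p T_o + p^2 T_(o+1) T_o - ..., with k+1 terms: the signed sum over the
    minimal coset representatives of S_k in S_(k+1). *)
Fixpoint cosetsum k o h : word -> V :=
  if k is k'.+1 then h - p *: cosetsum k' o.+1 (braid o h) else h.

(** The q-antisymmetrizer of the k letters at places o, ..., o+k-1, factored
    along S_1 < S_2 < ... < S_k.  At an increasing word this factorization is
    the Laplace expansion along the first row. *)
Fixpoint asym k o h : word -> V :=
  if k is k'.+1 then cosetsum k' o (asym k' o.+1 h) else h.

(** T_o ... T_(o+l-1): the letter at place o passes to the right of the next l
    letters. *)
Fixpoint passr l o h : word -> V :=
  if l is l'.+1 then braid o (passr l' o.+1 h) else h.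

(** The same product in the opposite order: the letter at place o+l passes to the
    left of the l letters before it. *)
Fixpoint passl l o h : word -> V :=
  if l is l'.+1 then passl l' o.+1 (braid o h) else h.

(** The positive braid by which a block of k letters, starting at place o, passes
    to the right of the next l letters. *)
Fixpoint swapr k l o h : word -> V :=
  if k is k'.+1 then swapr k' l o.+1 (passr l o h) else h.

(** The product of [swapr k l o] in the opposite order: a block of k letters passes
    to the left of the l letters before it.  Trading column braidings for row
    braidings reverses products, so both orders are needed. *)
Fixpoint swapl k l o h : word -> V :=
  if k is k'.+1 then passl l o (swapl k' l o.+1 h) else h.

Lemma cosetsum_is_linear k o : linear (cosetsum k o).
Proof.
move=> c g h; elim: k o g h => [|k IH] o g h //=.
rewrite linearP IH scalerBr scalerDr opprD addrACA; congr (_ - _ + _).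
by rewrite !scalerA mulrC.
Qed.
HB.instance Definition _ k o :=
  GRing.isLinear.Build K (word -> V) (word -> V) _ (cosetsum k o) (cosetsum_is_linear k o).

Lemma cosetsumB k o c d h g :
  cosetsum k o (c *: h - d *: g) = c *: cosetsum k o h - d *: cosetsum k o g.
Proof. by rewrite linearB !linearZ. Qed.

Lemma cosetsumD k o d h g :
  cosetsum k o (h + d *: g) = cosetsum k o h + d *: cosetsum k o g.
Proof. by rewrite linearD linearZ. Qed.

Lemma asym_is_linear k o : linear (asym k o).
Proof. by move=> c g h; elim: k o => [|k IH] o //=; rewrite IH linearP. Qed.
HB.instance Definition _ k o :=
  GRing.isLinear.Build K (word -> V) (word -> V) _ (asym k o) (asym_is_linear k o).

Lemma passr_is_linear k o : linear (passr k o).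
Proof. by move=> c g h; elim: k o => [|k IH] o //=; rewrite IH linearP. Qed.
HB.instance Definition _ k o :=
  GRing.isLinear.Build K (word -> V) (word -> V) _ (passr k o) (passr_is_linear k o).

Lemma swapr_is_linear k l o : linear (swapr k l o).
Proof. by move=> c g h; elim: k o g h => [|k IH] o g h //=; rewrite linearP IH. Qed.
HB.instance Definition _ k l o :=
  GRing.isLinear.Build K (word -> V) (word -> V) _ (swapr k l o) (swapr_is_linear k l o).

Lemma suppB N h g c : supp N h -> supp N g -> supp N (h - c *: g).
Proof. by move=> hN gN r sr; rewrite !funE hN // gN // scaler0 subr0. Qed.

Lemma cosetsum_supp N k o h : supp N h -> supp N (cosetsum k o h).
Proof.
by elim: k o h => [|k IH] o h //= hN; apply: suppB => //; apply/IH/braid_supp.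
Qed.

Lemma asym_supp N k o h : supp N h -> supp N (asym k o h).
Proof. by move=> hN; elim: k o => [|k IH] o //=; apply/cosetsum_supp. Qed.

(** Antisymmetrizers are polynomials in the braidings, so an operator that carries
    the braidings of one block to those of another carries the antisymmetrizer
    along. *)
Lemma cosetsum_slide (F : {linear (word -> V) -> (word -> V)}) k o o' :
    (forall i h, (i < k)%N -> F (braid (o + i) h) = braid (o' + i) (F h)) ->
  forall h, F (cosetsum k o h) = cosetsum k o' (F h).
Proof.
elim: k o o' => [|k IH] o o' slide h //=.
rewrite linearB linearZ /= (IH _ o'.+1) => [|i g ik]; last first.
  by rewrite !addSnnS slide.
by have := slide 0 h (ltn0Sn _); rewrite !addn0 => ->.
Qed.

Lemma asym_slide (F : {linear (word -> V) -> (word -> V)}) k o o' :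
    (forall i h, (i.+1 < k)%N -> F (braid (o + i) h) = braid (o' + i) (F h)) ->
  forall h, F (asym k o h) = asym k o' (F h).
Proof.
elim: k o o' => [|k IH] o o' slide h //=.
rewrite (cosetsum_slide (o' := o')) => [|i g ik]; last exact: slide.
by rewrite (IH _ o'.+1) // => i g ik; rewrite !addSnnS slide.
Qed.

Lemma braid_cosetsum k o s h : (s.+1 < o)%N ->
  braid s (cosetsum k o h) = cosetsum k o (braid s h).
Proof. by move=> so; apply: cosetsum_slide => i g _; apply: braid_comm; lia. Qed.

Lemma braid_asym k o s h : (s.+1 < o)%N ->
  braid s (asym k o h) = asym k o (braid s h).
Proof. by move=> so; apply: asym_slide => i g _; apply: braid_comm; lia. Qed.

(** The eigenvalue -p of T_s is the sign representation of the Hecke algebra. *)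
Definition qskew o m h := forall s, (o <= s < m)%N -> braid s h = - p *: h.

Lemma braid_sym N o h : (o.+1 < N)%N -> supp N h ->
  braid o (braid o h + p *: h) = p^-1 *: (braid o h + p *: h).
Proof.
move=> oN hN; rewrite linearD linearZ /= (braid_quad oN hN) scalerDr !scalerA.
by rewrite mulVf // scale1r -addrA -scalerDl subrK addrC.
Qed.

(** The first braiding is the only new one: for the others, [cosetsum] is computed
    from functions that are already skew.  For T_o, the first two terms of the
    sum combine through the quadratic relation and the rest, which contains
    T_(o+1) T_o, is skew by the Yang-Baxter equation. *)
Lemma cosetsum_skew N k o h : (o + k < N)%N -> supp N h ->
  qskew o.+1 (o + k) h -> qskew o (o + k) (cosetsum k o h).
Proof.
elim: k o h => [|k IH] o h oN hN sk s /andP[os sm]; first by lia.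
have [->|so] := eqVneq s o; last first.
  have o1s : (o.+1 <= s)%N by rewrite ltn_neqAle eq_sym so.
  rewrite /= linearB linearZ /= (IH _ (braid o h)); first last.
  - by rewrite o1s -addSnnS in sm *.
  - move=> t /andP[ot tm]; rewrite -braid_comm // (sk t) ?linearZ //.
    by rewrite (ltnW ot) -addSnnS.
  - exact: braid_supp.
  - by rewrite addSnnS.
  by rewrite (sk s) ?o1s // scalerBr !scalerA mulrC.
have quad : braid o h - p *: braid o (braid o h) = - p *: (h - p *: braid o h).
  rewrite (@braid_quad N) //; last by rewrite -addnS in oN; apply: leq_trans oN; lia.
  rewrite scalerDr scalerBr !scalerA.
  have -> : p * (p^-1 - p) = 1 - p * p by field.
  rewrite scalerBl scale1r opprD opprB mulNr !scaleNr opprK.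
  by rewrite addrCA [X in _ + X]addrC subrK.
case: k IH oN sk sm => [|k] _ oN sk sm; first by rewrite /= linearB linearZ.
(* T_o T_(o+1) T_o = T_(o+1) T_o T_(o+1), and T_(o+1) acts on h by -p. *)
have sk1 : braid o (braid o.+1 (braid o h)) = - p *: braid o.+1 (braid o h).
  by rewrite braid_YB (sk o.+1) ?linearZ //= ltnSn /=; lia.
rewrite /= !braidB braid_cosetsum // sk1 [cosetsum _ _ (_ *: _)]linearZ /=.
move: (cosetsum k _ _) => EW.
rewrite [p *: (_ - p *: (- p *: _))]scalerBr opprB addrCA quad.
rewrite [p *: (braid o h - p *: EW)]scalerBr opprB [in RHS]addrCA [RHS]scalerDr !scalerA.
by have -> : p * p * - p = - p * p * p by ring.
Qed.

Lemma asym_skew N k o h : (o + k <= N)%N -> supp N h ->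
  qskew o (o + k).-1 (asym k o h).
Proof.
elim: k o h => [|k IH] o h oN hN s /andP[os sm]; first by lia.
rewrite /= (cosetsum_skew _ (asym_supp k o.+1 hN)) //; first by rewrite -addnS.
  rewrite -[(o + k)%N]/((o.+1 + k).-1); apply: IH => //.
  by rewrite addSnnS.
by rewrite os addnS in sm *.
Qed.

(** Two consecutive coset sums antisymmetrize the first two letters with respect
    to each other as well as to the rest, and T_o + p symmetrizes these two. *)
Lemma cosetsum_sym N k o h : (o + k.+1 < N)%N -> supp N h ->
  cosetsum k.+1 o (cosetsum k o.+1 (braid o h + p *: h)) = 0.
Proof.
elim: k o h => [|k IH] o h oN hN.
  rewrite addn1 in oN; rewrite /= (braid_sym oN hN) scalerA mulfV // scale1r.
  exact: subrr.
set g := braid o h + p *: h.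
have gN : supp N g by rewrite /g -[p]opprK scaleNr; apply/suppB/hN/braid_supp.
have sg : braid o g = p^-1 *: g by apply: (@braid_sym N) => //; lia.
have ybg : braid o (braid o.+1 g) =
    braid o.+1 (braid o (braid o.+1 h)) + p *: braid o (braid o.+1 h).
  by rewrite /g !(linearD, linearZ) /= braid_YB.
have cg : braid o (cosetsum k.+1 o.+1 g) =
    p^-1 *: g - p *: cosetsum k o.+2 (braid o (braid o.+1 g)).
  by rewrite /= braidB sg braid_cosetsum.
have cc0 : cosetsum k.+1 o.+1 (cosetsum k o.+2 (braid o (braid o.+1 g))) = 0.
  by rewrite ybg IH //; [lia | do 2![apply: braid_supp]].
rewrite -[LHS]/(cosetsum k.+1 o.+1 g -
  p *: cosetsum k.+1 o.+1 (braid o (cosetsum k.+1 o.+1 g))).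
rewrite cg cosetsumB cc0.
rewrite scaler0 subr0 scalerA mulfV // scale1r.
exact: subrr.
Qed.

Lemma asym_braid N k o s h : (o + k <= N)%N -> supp N h -> (o <= s)%N -> (s.+1 < o + k)%N ->
  asym k o (braid s h) = - p *: asym k o h.
Proof.
elim: k o h => [|k IH] o h oN hN os sm; first by lia.
have [->|so] := eqVneq s o; last first.
  by rewrite /= (IH o.+1) // ?linearZ //; lia.
case: k IH oN sm => [|k] IH oN sm; first by lia.
have := @cosetsum_sym N k o (asym k o.+2 h); rewrite braid_asym // => cc0.
rewrite !cosetsumD in cc0.
apply/eqP; rewrite scaleNr -addr_eq0; apply/eqP; apply: cc0.
  by apply: leq_trans oN; rewrite !addnS.
exact: asym_supp.
Qed.

(** * Exchanging two blocks of letters *)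

Lemma passr_slide (F : {linear (word -> V) -> (word -> V)}) k o o' :
    (forall i h, (i < k)%N -> F (braid (o + i) h) = braid (o' + i) (F h)) ->
  forall h, F (passr k o h) = passr k o' (F h).
Proof.
elim: k o o' => [|k IH] o o' slide h //=.
have := slide 0 (passr k o.+1 h) (ltn0Sn _); rewrite !addn0 => ->.
by rewrite (IH _ o'.+1) // => i g ik; rewrite !addSnnS slide.
Qed.

Lemma braid_passr l o t h : (t.+1 < o)%N || (o + l < t)%N ->
  braid t (passr l o h) = passr l o (braid t h).
Proof.
move=> so; apply: passr_slide => i g il; case/orP: so => so.
  by apply: braid_comm; lia.
by apply/esym/braid_comm; lia.
Qed.

Lemma passr_braid l o i h : (i.+1 < l)%N ->
  passr l o (braid (o + i) h) = braid (o + i).+1 (passr l o h).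
Proof.
elim: l o i h => [|l IH] o [|i] h // il.
  case: l IH il => // l IH il; rewrite addn0 /= -(@braid_passr l o.+2) ?ltnSn //.
  exact: braid_YB.
rewrite /= -addSnnS IH // braid_comm //; lia.
Qed.

Lemma passrS l o h : passr l.+1 o h = passr l o (braid (o + l) h).
Proof.
elim: l o => [|l IH] o; first by rewrite addn0.
by rewrite -[LHS]/(braid o (passr l.+1 o.+1 h)) IH addSnnS.
Qed.

(** Two adjacent letters that both pass a block can be braided before or after;
    this is the identity by which a block of passing letters keeps its
    antisymmetrizer. *)
Lemma passr_passr_braid l o h :
  passr l o.+1 (passr l o (braid (o + l) h)) = braid o (passr l o.+1 (passr l o h)).
Proof.
rewrite -passrS -[RHS]/(passr l.+1 o (passr l o h)); apply/esym.
by apply: passr_slide => i g il; rewrite addSn; apply: passr_braid.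
Qed.

Lemma braid_swapr k l o t h : (t.+1 < o)%N ->
  braid t (swapr k l o h) = swapr k l o (braid t h).
Proof.
elim: k o h => [|k IH] o h //= to; rewrite IH; last exact: ltnW.
by rewrite braid_passr // to.
Qed.

Lemma swapr_braid_right k l o i h : (i.+1 < l)%N ->
  swapr k l o (braid (o + i) h) = braid (o + k + i) (swapr k l o h).
Proof.
elim: k o h => [|k IH] o h il; first by rewrite addn0.
by rewrite /= passr_braid // IH // addSnnS.
Qed.

Lemma swapr_braid_left k l o i h : (i.+1 < k)%N ->
  swapr k l o (braid (o + l + i) h) = braid (o + i) (swapr k l o h).
Proof.
elim: k o i h => [|k IH] o [|i] h // ik; last first.
  rewrite /= -braid_passr; last by apply/orP; right; lia.
  by rewrite addnS -!addSn IH // addSnnS.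
case: k IH ik => // k _ _; rewrite /= !addn0 passr_passr_braid.
by rewrite braid_swapr.
Qed.

Lemma swapr_asym_right k l o h :
  swapr k l o (asym l o h) = asym l (o + k) (swapr k l o h).
Proof. by apply: asym_slide => i g il; apply: swapr_braid_right. Qed.

Lemma swapr_asym_left k l o h :
  swapr k l o (asym k (o + l) h) = asym k o (swapr k l o h).
Proof. by apply: asym_slide => i g il; apply: swapr_braid_left. Qed.

(** All operators are local: those starting at place o+1 ignore the first
    letter. *)
Lemma cosetsum_cons k o h a r :
  cosetsum k o.+1 h (a :: r) = cosetsum k o (fun r' => h (a :: r')) r.
Proof. by elim: k o h => [|k IH] o h //=; rewrite !funE IH. Qed.

Lemma asym_cons k o h a r :
  asym k o.+1 h (a :: r) = asym k o (fun r' => h (a :: r')) r.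
Proof.
elim: k o r => [|k IH] o r //=; rewrite cosetsum_cons; congr (cosetsum _ _ _ _).
by apply/funext => r'; apply: IH.
Qed.

Lemma passr_cons k o h a r :
  passr k o.+1 h (a :: r) = passr k o (fun r' => h (a :: r')) r.
Proof.
elim: k o r => [|k IH] o r //=; rewrite braidSE; congr (braid _ _ _).
by apply/funext => r'; apply: IH.
Qed.

Lemma swapr_cons k l o h a r :
  swapr k l o.+1 h (a :: r) = swapr k l o (fun r' => h (a :: r')) r.
Proof.
elim: k o h r => [|k IH] o h r //=; rewrite IH; congr (swapr _ _ _ _ _).
by apply/funext => r'; apply: passr_cons.
Qed.

Lemma passl_cons k o h a r :
  passl k o.+1 h (a :: r) = passl k o (fun r' => h (a :: r')) r.
Proof. by elim: k o h => [|k IH] o h //=; rewrite IH. Qed.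

Lemma swapl_cons k l o h a r :
  swapl k l o.+1 h (a :: r) = swapl k l o (fun r' => h (a :: r')) r.
Proof.
elim: k o r => [|k IH] o r //=; rewrite passl_cons; congr (passl _ _ _ _).
by apply/funext => r'; apply: IH.
Qed.

Lemma braid_cat u t h r : braid (size u + t) h (u ++ r) = braid t (fun r' => h (u ++ r')) r.
Proof. by elim: u h => [|a u IH] h //=; rewrite addSn braidSE IH. Qed.

Lemma asym_cat u k h r : asym k (size u) h (u ++ r) = asym k 0 (fun r' => h (u ++ r')) r.
Proof. by elim: u h => [|a u IH] h //=; rewrite asym_cons IH. Qed.

(** * Triangularity of the block exchange *)

(** When x meets a smaller letter, the correction term exchanges their roles, and
    the letter that continues to the right is the smaller one.  If h vanishes on
    all words where a letter below x reaches the end, the leading term is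
    left. *)
Lemma passr_eval h x v u :
    (forall x' v', perm_eq (x' :: v') (x :: v) -> (x' < x)%N -> h (v' ++ x' :: u) = 0) ->
  exists e : int, passr (size v) 0 h (x :: v ++ u) = p ^ e *: h (v ++ x :: u).
Proof.
elim: v x h => [|y v IH] x h h0; first by exists 0; rewrite expr0z scale1r.
have [|e /= ey] := IH x (fun r' => h (y :: r')).
  move=> x' v' pv xx; apply: (h0 x' (y :: v')) => //.
  rewrite (perm_catCA [:: x'] [:: y]) (perm_sym _ (x :: _)).
  by rewrite (perm_catCA [:: x] [:: y]) /= perm_cons perm_sym.
rewrite /= braid0E !passr_cons ey.
exists ((if x == y then -1 else 0) + e).
rewrite expfzDr // scalerA; case: ltnP => [yx|_]; last first.
  by rewrite scale0r addr0; case: eqP => _; rewrite ?expr0z.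
have [|f /= ->] := IH y (fun r' => h (x :: r')).
  move=> x' v' pv xx; apply: (h0 x' (x :: v')); last exact: ltn_trans yx.
  by rewrite (perm_catCA [:: x'] [:: x]) /= perm_cons.
rewrite (h0 y (x :: v)) // ?(perm_catCA [:: y] [:: x]) // !scaler0 addr0.
by case: eqP => _; rewrite ?expr0z.
Qed.

(** The sum of the letters; a correction term strictly changes the weight of each
    block. *)
Definition weight u := (\sum_(x <- u) x)%N.

Lemma weight_cons x u : weight (x :: u) = (x + weight u)%N.
Proof. exact: big_cons. Qed.

Lemma swapr_eval h u v :
    (forall u' v', size u' = size u -> perm_eq (u' ++ v') (u ++ v) ->
       (weight u' < weight u)%N -> h (v' ++ u') = 0) ->
  exists e : int, swapr (size u) (size v) 0 h (u ++ v) = p ^ e *: h (v ++ u).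
Proof.
elim: u h => [|x u IH] h h0; first by exists 0; rewrite cats0 expr0z scale1r.
have [|e /= e1] := passr_eval (h := h) (x := x) (v := v) (u := u).
  move=> x' v' pv xx; apply: h0 => //; last by rewrite !weight_cons ltn_add2r.
  apply/seq.permP => c; move/seq.permP: pv => /(_ c) /=; rewrite /= !count_cat /=; lia.
rewrite /= swapr_cons.
have [|f ->] := IH (fun r' => passr (size v) 0 h (x :: r')).
  move=> u' v' su pu wu.
  have sv : size v' = size v.
    by move/perm_size: pu; rewrite !size_cat su => /addnI.
  rewrite -sv; have [|f ->] := passr_eval (h := h) (x := x) (v := v') (u := u').
    move=> x' v2 pv xx; apply: h0; rewrite ?weight_cons /= ?su //; last by lia.
    apply/seq.permP => c; move/seq.permP: pv => /(_ c) /=; move/seq.permP: pu => /(_ c).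
    rewrite /= !count_cat /=; lia.
  rewrite (h0 (x :: u')) ?scaler0 ?weight_cons /= ?su ?ltn_add2l //.
  by rewrite perm_cons.
by exists (f + e); rewrite e1 scalerA expfzDr.
Qed.

(** The mirror image of [passr_eval]: moving left, a letter can only be replaced
    by a larger one. *)
Lemma passl_eval h x v u :
    (forall x' v', perm_eq (x' :: v') (x :: v) -> (x < x')%N -> h (x' :: v' ++ u) = 0) ->
  exists e : int, passl (size v) 0 h (v ++ x :: u) = p ^ e *: h (x :: v ++ u).
Proof.
elim: v x h => [|y v IH] x h h0; first by exists 0; rewrite expr0z scale1r.
have hyx x' v' : perm_eq (x' :: v') (x :: v) -> (x < x')%N ->
    h (x' :: y :: v' ++ u) = 0.
  move=> pv; apply: (h0 x' (y :: v')).
  by apply/seq.permP => c; move/seq.permP: pv => /(_ c) /=; lia.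
have hy v' : perm_eq v' (x :: v) -> (x < y)%N -> h (y :: v' ++ u) = 0.
  move=> pv; apply: (h0 y v').
  by apply/seq.permP => c; move/seq.permP: pv => /(_ c) /=; lia.
rewrite /= passl_cons.
have [|e ->] := IH x (fun r' => braid 0 h (y :: r')).
  move=> x' v' pv xx; rewrite braid0E hyx // scaler0 add0r.
  case: ltnP => x'y; last by rewrite scale0r.
  by rewrite (hy (x' :: v')) ?scaler0 //; apply: ltn_trans x'y.
rewrite braid0E; exists (e + (if y == x then -1 else 0)).
rewrite expfzDr // -scalerA; congr (_ *: _).
have -> : (if (x < y)%N then p^-1 - p else 0) *: h [:: y, x & v ++ u] = 0.
  by case: ltnP => xy; rewrite ?scale0r // (hy (x :: v)) ?scaler0.
by rewrite addr0; case: eqP => _; rewrite ?expr0z.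
Qed.

Lemma swapl_eval h u v :
    (forall u' v', size u' = size u -> perm_eq (u' ++ v') (u ++ v) ->
       (weight u < weight u')%N -> h (u' ++ v') = 0) ->
  exists e : int, swapl (size u) (size v) 0 h (v ++ u) = p ^ e *: h (u ++ v).
Proof.
elim: u v h => [|x u IH] v h h0; first by exists 0; rewrite cats0 expr0z scale1r.
have [|e /= ->] := passl_eval (h := swapl (size u) (size v) 1 h) (x := x) (v := v) (u := u).
  move=> x' v' pv xx.
  have sv : size v = size v' by have /perm_size [] := pv.
  rewrite swapl_cons sv; have [|f ->] := IH v' (fun r' => h (x' :: r')).
    move=> u2 v2 su pu wu; apply: (h0 (x' :: u2)); rewrite ?weight_cons /= ?su //; last by lia.
    apply/seq.permP => c; move/seq.permP: pv => /(_ c) /=; move/seq.permP: pu => /(_ c).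
    rewrite /= !count_cat /=; lia.
  rewrite (h0 (x' :: u)) ?scaler0 ?weight_cons ?ltn_add2r //=.
  apply/seq.permP => c; move/seq.permP: pv => /(_ c) /=; rewrite /= !count_cat /=; lia.
rewrite swapl_cons; have [|f ->] := IH v (fun r' => h (x :: r')).
  move=> u' v' su pu wu; apply: (h0 (x :: u')); rewrite ?weight_cons ?ltn_add2l ?perm_cons //=.
  by rewrite su.
by exists (e + f); rewrite scalerA expfzDr.
Qed.

(** * Skew functions vanish on repeated letters *)

(** For equal letters T_t acts by 1/p, which differs from -p because p^2 is not
    -1.  For distinct letters the eigenvalue equation makes the values before
    and after the exchange proportional. *)
Lemma qskew_adjacent h u a b r :
    braid (size u) h (u ++ a :: b :: r) = - p *: h (u ++ a :: b :: r) ->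
    p ^+ 2 != -1 -> a = b \/ h (u ++ b :: a :: r) = 0 ->
  h (u ++ a :: b :: r) = 0.
Proof.
move=> hsk p2 hab; apply/eqP; move: hsk; rewrite -[size u]addn0 braid_cat braid0E.
set d := (if (b < a)%N then _ else _).
set X := h (u ++ [:: a, b & r]).
have [e e0 ->] : exists2 e, e + p != 0 &
    (if a == b then p^-1 else 1) *: h (u ++ [:: b, a & r]) + d *: X = e *: X.
  case: hab => [ab|->]; last first.
    exists d; last by rewrite scaler0 add0r.
    by rewrite /d; case: ifP => _; rewrite ?subrK ?add0r // invr_eq0.
  rewrite /X /d -ab eqxx ltnn scale0r addr0; exists p^-1 => //.
  apply: contra p2 => /eqP pp; rewrite -subr_eq0 opprK.
  have -> : p ^+ 2 + 1 = p * (p^-1 + p) by field.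
  by rewrite pp mulr0.
by move/eqP; rewrite -subr_eq0 -scalerBl opprK scaler_eq0 (negPf e0).
Qed.

Lemma qskew_repeat h u v r : p ^+ 2 != -1 ->
  qskew (size u) (size u + size v).-1 h -> ~~ uniq v -> h (u ++ v ++ r) = 0.
Proof.
move=> p2 hsk vdup.
have sw v1 a b v2 : size v = (size v1 + (size v2).+2)%N ->
    a = b \/ h (u ++ v1 ++ b :: a :: v2 ++ r) = 0 ->
  h (u ++ v1 ++ a :: b :: v2 ++ r) = 0.
  move=> sv; rewrite !(catA u v1); apply: qskew_adjacent p2.
  by rewrite hsk // size_cat; lia.
have dup v2 v1 v3 a : size v = (size v1 + (size v2 + size v3).+2)%N ->
    h (u ++ v1 ++ a :: v2 ++ a :: v3 ++ r) = 0.
  elim: v2 v1 => [|b v2 IH] v1 sv; first by apply: sw; [rewrite sv | left].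
  have := sw v1 a b (v2 ++ a :: v3); rewrite -catA /=; apply.
    by rewrite size_cat /= sv /=; lia.
  right; have := IH (rcons v1 b); rewrite -cats1 -!catA /=; apply.
  by rewrite size_cat /= sv /=; lia.
have [a [v1 [v2 [v3 ev]]]] := not_uniq_split vdup.
rewrite ev -!catA /= -catA; apply: dup.
by rewrite ev !size_cat /= size_cat /=; lia.
Qed.

End Operators.
End Braid.
Arguments braid : simpl never.

(** * Extremal distributions of letters *)

Section Weights.
Variable n : nat.
Implicit Types (u v : seq 'I_n) (J D : {set 'I_n}).

Lemma weight_enum J : weight (enum J) = (\sum_(j in J) j)%N.
Proof. by rewrite /weight big_enum. Qed.

Lemma weight_uniq u : uniq u -> weight u = (\sum_(j in [set x in u]) j)%N.
Proof.
move=> uu; rewrite /weight -[RHS]big_enum; apply: perm_big.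
by apply: uniq_perm; rewrite ?enum_uniq // => x; rewrite mem_enum inE.
Qed.

Lemma weight_cat u v : weight (u ++ v) = (weight u + weight v)%N.
Proof. by rewrite /weight big_cat. Qed.

Lemma weight_le_below D1 D2 : #|D1| = #|D2| ->
    (forall x y, x \in D1 -> y \in D2 -> (x < y)%N) ->
  (\sum_(j in D1) j <= \sum_(j in D2) j)%N.
Proof.
move=> c12 lt12; have [->|[x0 x0D]] := set_0Vmem D1; first by rewrite big_set0.
case: (arg_maxnP (fun x : 'I_n => x : nat) x0D) => x xD xmax.
apply: (@leq_trans (\sum_(j in D1) x)); first by apply: leq_sum => j /xmax.
rewrite sum_nat_const c12 -sum_nat_const; apply: leq_sum => j jD.
exact/ltnW/lt12.
Qed.

(** Each letter common to J and J' occurs twice, hence once in u and once in v; so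
    u differs from J only by trading elements of J \ J' for elements of J' \ J. *)
Lemma min_weight J J' u v : uniq u -> uniq v -> size u = #|J| ->
    perm_eq (u ++ v) (enum J ++ enum J') ->
    (forall x y, x \in J :\: J' -> y \in J' :\: J -> (x < y)%N) ->
  (weight (enum J) <= weight u)%N.
Proof.
move=> uu uv su pu lt; rewrite weight_enum (weight_uniq uu).
set U := [set x in u].
have cU : #|U| = #|J| by rewrite -su cardsE; apply/card_uniqP.
have cnt x : ((x \in u) + (x \in v) = (x \in J) + (x \in J'))%N.
  have /seq.permP /(_ (pred1 x)) := pu; rewrite !count_cat.
  by rewrite !count_uniq_mem ?enum_uniq // !mem_enum.
rewrite (big_setID U) [X in (_ <= X)%N](big_setID J) /= setIC leq_add2l.
apply: weight_le_below => [|x y].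
  by apply/eqP; rewrite -(eqn_add2l #|J :&: U|) cardsID setIC cardsID cU.
rewrite !inE => /andP[xu xJ] /andP[yJ yu]; apply: lt; rewrite !inE.
  by rewrite xJ andbT; have := cnt x; rewrite (negPf xu) xJ; case: (x \in v); case: (x \in J').
by rewrite yJ; have := cnt y; rewrite (negPf yJ) yu; case: (y \in v); case: (y \in J').
Qed.

(** The total weight is fixed, so this is [min_weight] for v and J'. *)
Lemma max_weight J J' u v : uniq u -> uniq v -> size u = #|J| ->
    perm_eq (u ++ v) (enum J ++ enum J') ->
    (forall x y, x \in J :\: J' -> y \in J' :\: J -> (y < x)%N) ->
  (weight u <= weight (enum J))%N.
Proof.
move=> uu uv su pu lt.
have sv : size v = #|J'|.
  by move/perm_size: pu; rewrite !size_cat su -!cardE => /addnI.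
have: (weight u + weight v = weight (enum J) + weight (enum J'))%N.
  by rewrite -!weight_cat /weight (perm_big _ pu).
have := @min_weight J' J v u uv uu sv.
rewrite perm_catC perm_sym perm_catC perm_sym pu => /(_ isT) m.
have {}m := m (fun x y hx hy => lt y x hy hx).
lia.
Qed.

End Weights.

(** * Change of values and restriction to a block *)

(** The operators are linear combinations of evaluations at words, so they commute
    with linear maps between the modules of values.  With values that are
    themselves functions of a second word, this says that operators on row words
    commute with operators on column words. *)
Section Naturality.
Variables (K : fieldType) (p : K) (n : nat) (V V' : lmodType K) (L : V -> V').
Hypotheses (L0 : L 0 = 0) (LP : forall c x d y, L (c *: x + d *: y) = c *: L x + d *: L y).
Implicit Types (h : seq 'I_n -> V) (w : seq 'I_n).

Lemma braid_nat t h w : L (braid p t h w) = braid p t (fun u => L (h u)) w.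
Proof. by elim: t h w => [|t IH] h [|a [|b r]] //=; rewrite ?braid0E ?braidSE. Qed.

Lemma cosetsum_nat k o h w : L (cosetsum p k o h w) = cosetsum p k o (fun u => L (h u)) w.
Proof.
elim: k o h => [|k IH] o h //=.
rewrite !funE; have := LP 1 (h w) (- p) (cosetsum p k o.+1 (braid p o h) w).
rewrite !scale1r !scaleNr IH => ->; congr (_ - _ *: cosetsum _ _ _ _ _).
by apply/funext => u; apply: braid_nat.
Qed.

Lemma asym_nat k o h w : L (asym p k o h w) = asym p k o (fun u => L (h u)) w.
Proof.
elim: k o w => [|k IH] o w //=; rewrite cosetsum_nat.
by congr (cosetsum _ _ _ _ _); apply/funext => u; apply: IH.
Qed.

Lemma passl_nat k o h w : L (passl p k o h w) = passl p k o (fun u => L (h u)) w.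
Proof.
elim: k o h => [|k IH] o h //=; rewrite IH.
by congr (passl _ _ _ _ _); apply/funext => u; apply: braid_nat.
Qed.

Lemma swapl_nat k l o h w : L (swapl p k l o h w) = swapl p k l o (fun u => L (h u)) w.
Proof.
elim: k o w => [|k IH] o w //=; rewrite passl_nat.
by congr (passl _ _ _ _ _); apply/funext => u; apply: IH.
Qed.

End Naturality.

(** Operators acting on the beginning of a word ignore a fixed end r.  The support
    condition gives an equality of functions: words of another length contribute
    0 on both sides. *)
Section RightContext.
Variables (K : fieldType) (p : K) (n : nat) (V : lmodType K).
Implicit Types (h : seq 'I_n -> V) (r s : seq 'I_n).

Lemma supp_catr N h r : supp N h -> (size r <= N)%N ->
  supp (N - size r)%N (fun s => h (s ++ r)).
Proof. by move=> hN rN s sN; rewrite hN // size_cat; lia. Qed.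

Lemma braid_catr N t h r : supp N h -> (t.+1 + size r < N)%N ->
  (fun s => braid p t h (s ++ r)) = braid p t (fun s => h (s ++ r)).
Proof.
move=> hN tN; apply/funext => s.
have [sN|sN] := eqVneq (size s) (N - size r)%N; last first.
  rewrite (braid_supp _ _ (supp_catr hN _) sN); last by lia.
  by apply: (braid_supp _ _ hN); rewrite size_cat; lia.
have {}tN : (t.+1 < size s)%N by lia.
elim: t s h tN {hN sN} => [|t IH] [|a [|b s]] h //= ts.
exact: (IH (b :: s) (fun r' => h (a :: r'))).
Qed.

Lemma cosetsum_catr N k o h r : supp N h -> (o + k + size r < N)%N ->
  (fun s => cosetsum p k o h (s ++ r)) = cosetsum p k o (fun s => h (s ++ r)).
Proof.
elim: k o h => [|k IH] o h //= hN kN; apply/funext => s; rewrite !funE.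
rewrite -[cosetsum _ _ _ _ _]/((fun s => cosetsum p k o.+1 (braid p o h) (s ++ r)) s).
rewrite IH; [|exact: braid_supp|by rewrite addSnnS].
by rewrite (braid_catr hN) //; lia.
Qed.

Lemma asym_catr N k o h r : supp N h -> (o + k + size r <= N)%N ->
  (fun s => asym p k o h (s ++ r)) = asym p k o (fun s => h (s ++ r)).
Proof.
elim: k o h => [|k IH] o h //= hN kN.
rewrite (cosetsum_catr (asym_supp p k o.+1 hN)); last by lia.
by rewrite IH //; lia.
Qed.

End RightContext.

(** * Words in the entries of a quantum matrix *)

Section MatrixWords.
Variables (K : fieldType) (p : K) (m n : nat) (A : algType K) (z : 'I_m -> 'I_n -> A).
Hypothesis p0 : p != 0.
Hypothesis z_row : forall i (j k : 'I_n), (j < k)%N -> z i j * z i k = p *: (z i k * z i j).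
Hypothesis z_col : forall (i k : 'I_m) j, (i < k)%N -> z i j * z k j = p *: (z k j * z i j).
Hypothesis z_anti : forall (i s : 'I_m) (j t : 'I_n), (s < i)%N -> (j < t)%N ->
  z i j * z s t = z s t * z i j.
Hypothesis z_diag : forall (i s : 'I_m) (j t : 'I_n), (i < s)%N -> (j < t)%N ->
  z i j * z s t = z s t * z i j + (p - p^-1) *: (z i t * z s j).
Implicit Types (w : seq 'I_m) (v : seq 'I_n).

(** The value 0 on words of different lengths makes [monz w] a function on words of
    one length, where the quadratic Hecke relation holds. *)
Fixpoint monz w v : A :=
  match w, v with
  | [::], [::] => 1
  | i :: w', j :: v' => z i j * monz w' v'
  | _, _ => 0
  end.

Lemma monz_supp w : supp (size w) (monz w).
Proof. by elim: w => [|i w IH] [|j v] //= sv; rewrite IH ?mulr0. Qed.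

Lemma monz_cat w1 w2 v1 v2 : size w1 = size v1 ->
  monz (w1 ++ w2) (v1 ++ v2) = monz w1 v1 * monz w2 v2.
Proof.
elim: w1 v1 => [|i w1 IH] [|j v1] //= => [_|[sv]]; first by rewrite mul1r.
by rewrite IH // mulrA.
Qed.

(** The RTT form of the defining relations: for two letters, each of the cases
    below is one of the four relations. *)
Lemma monz_RTT t w v : braid p t (fun w' => monz w' v) w = braid p t (monz w) v.
Proof.
elim: t w v => [|t IH] [|i w] [|j v].
- by [].
- by case: v => [|j' v] //; rewrite braid0E !scaler0 addr0.
- by case: w => [|i' w] //; rewrite braid0E !scaler0 addr0.
- case: w v => [|i' w] [|j' v] //; first by rewrite braid0E /= !mulr0 !scaler0 addr0.
    by rewrite braid0E /= !mulr0 !scaler0 addr0.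
  rewrite !braid0E /= !mulrA !scalerAl -!mulrDl; congr (_ * _).
  rewrite -!val_eqE /=.
  case: (ltngtP i i') => [ii|ii|/val_inj ii]; case: (ltngtP j j') => [jj|jj|/val_inj jj];
    subst; rewrite -?scalerAl ?scale1r ?scale0r ?addr0 //.
  + by rewrite z_anti.
  + rewrite (z_diag ii jj) -addrA -scalerDl.
    by rewrite -[p^-1 - p]opprB subrr scale0r addr0.
  + by rewrite (z_col _ ii) scalerA mulVf // scale1r.
  + rewrite (z_diag ii jj) (z_anti ii jj) -addrA -scalerDl.
    by rewrite -[p^-1 - p]opprB subrr scale0r addr0.
  + by rewrite (z_anti ii jj).
  + by rewrite (z_col _ ii) -scalerDl addrC subrK.
  + by rewrite (z_row _ jj) scalerA mulVf // scale1r.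
  + by rewrite (z_row _ jj) -scalerDl addrC subrK.
- by [].
- rewrite braidSE -[braid p t.+1 _ [::]]/0.
  by rewrite (_ : (fun r' => _) = 0) ?linear0 //; apply/funext.
- rewrite braidSE -[braid p t.+1 _ [::]]/0.
  by rewrite (_ : (fun r' => _) = 0) ?linear0 //; apply/funext.
rewrite !braidSE.
rewrite -[LHS](@braid_nat _ p _ _ _ (fun x => z i j * x)) ?mulr0 // => [|c x d y]; last first.
  by rewrite mulrDr !scalerAr.
rewrite -[RHS](@braid_nat _ p _ _ _ (fun x => z i j * x)) ?mulr0 // => [|c x d y]; last first.
  by rewrite mulrDr !scalerAr.
by rewrite IH.
Qed.

(** [monz_RTT] with [monz] read as a function of row words, with values in the
    functions of column words. *)
Lemma monz_braid t w : braid p t monz w = braid p t (monz w).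
Proof.
apply/funext => v; rewrite -monz_RTT.
exact: (@braid_nat _ p _ _ _ (fun f : seq 'I_n -> A => f v)).
Qed.

Lemma monz_pass l o w : passr p l o (monz w) = passl p l o monz w.
Proof.
elim: l o w => [|l IH] o w //=; rewrite IH.
rewrite (@passl_nat _ p _ _ _ (braid p o)) ?linear0 //; last first.
  by move=> c x d y; rewrite linearD !linearZ.
by congr (passl _ _ _ _ _); apply/funext => u; rewrite monz_braid.
Qed.

(** Column braidings commute with row braidings, so trading them one by one
    reverses their order. *)
Lemma monz_swap k l o w : swapr p k l o (monz w) = swapl p k l o monz w.
Proof.
elim: k o w => [|k IH] o w //=; rewrite monz_pass.
rewrite (@passl_nat _ p _ _ _ (swapr p k l o.+1)) ?linear0 //; last first.
  by move=> c x d y; rewrite linearD !linearZ.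
by congr (passl _ _ _ _ _); apply/funext => u; rewrite IH.
Qed.

Lemma asym_comm (V : lmodType K) k o l o' (h : seq 'I_n -> V) : (o + k <= o')%N ->
  asym p l o' (asym p k o h) = asym p k o (asym p l o' h).
Proof. by move=> oo; apply: asym_slide => i g ik; apply/esym/braid_asym; lia. Qed.

Lemma asym_monz_cat w1 w2 v1 v2 k l :
    size w1 = l -> size v1 = l -> size w2 = k -> size v2 = k ->
  asym p l 0 (asym p k l (monz (w1 ++ w2))) (v1 ++ v2) =
  asym p l 0 (monz w1) v1 * asym p k 0 (monz w2) v2.
Proof.
move=> sw1 sv1 sw2 sv2.
have sN : supp (l + k)%N (monz (w1 ++ w2)).
  by rewrite -sw1 -sw2 -size_cat; apply: monz_supp.
have := @asym_catr _ p _ _ _ l 0 _ v2 (asym_supp p k l sN).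
rewrite sv2 => /(_ (leqnn _)) /(congr1 (fun f => f v1)) /= ->.
rewrite (@asym_nat _ p _ _ _ (fun x => x * asym p k 0 (monz w2) v2)) ?mul0r //; last first.
  by move=> c x d y; rewrite mulrDl !scalerAl.
congr (asym _ _ _ _ _); apply/funext => s.
have [ss|ss] := eqVneq (size s) l; last first.
  rewrite (asym_supp p k l sN) ?monz_supp ?mul0r ?sw1 //.
  by rewrite size_cat sv2 eqn_add2r.
rewrite -ss asym_cat (@asym_nat _ p _ _ _ (fun x => monz w1 s * x)) ?mulr0 //; last first.
  by move=> c x d y; rewrite mulrDr !scalerAr.
by congr (asym _ _ _ _ _); apply/funext => r; rewrite monz_cat // sw1.
Qed.

(** On increasing words this is the quantum minor; see [qminor_wminor]. *)
Definition wminor w v : A := asym p (size w) 0 (monz w) v.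

(** With w = I' I as row word and v = J J' as column word, compute in two ways the
    value at v of the column exchange applied to the product antisymmetrized in
    two blocks.  Directly, its only surviving term is at J' J, which yields
    [I'|J'][I|J].  Sliding the braid through the antisymmetrizers and trading it
    for a row exchange, its only surviving term is at I I', which yields
    [I|J][I'|J']. *)
Lemma wminor_qcommute (I I' : {set 'I_m}) (J J' : {set 'I_n}) :
    p ^+ 2 != -1 -> #|I| = #|J| -> #|I'| = #|J'| ->
    (forall x y, x \in J :\: J' -> y \in J' :\: J -> (x < y)%N) ->
    (forall x y, x \in I :\: I' -> y \in I' :\: I -> (y < x)%N) ->
  exists e : int, wminor (enum I) (enum J) * wminor (enum I') (enum J') =
    p ^ e *: (wminor (enum I') (enum J') * wminor (enum I) (enum J)).
Proof.
move=> p2 cI cI' ltJ ltI.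
have szI := cardE I; have szI' := cardE I'; have szJ := cardE J; have szJ' := cardE J'.
set k := #|J| in cI szJ; set l := #|J'| in cI' szJ'.
pose w := enum I' ++ enum I; pose v := enum J ++ enum J'.
have wN : supp (l + k)%N (monz w).
  by rewrite -cI -cI' szI szI' -size_cat; apply: monz_supp.
(* Column blocks of sizes l, k: skew in the column word. *)
pose Psi := asym p l 0 (asym p k l (monz w)).
have PsiE : Psi = asym p k l (asym p l 0 (monz w)) by rewrite asym_comm.
have [u' v' su pu wu|e eA] := @swapr_eval _ p _ p0 _ Psi (enum J) (enum J').
  have sv' : size v' = l by move/perm_size: pu; rewrite !size_cat su -szJ -szJ' => /addnI.
  apply/eqP; apply: contraLR wu => Psi0; rewrite -leqNgt.
  apply: (@min_weight _ J J' u' v') => //; last by rewrite su -szJ.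
    apply: contraNT Psi0 => uu; apply/eqP.
    have := @qskew_repeat _ p _ p0 _ Psi v' u' [::] p2; rewrite cats0; apply=> //.
    rewrite sv' su -szJ PsiE; apply: (@asym_skew _ p _ p0 _ (l + k)) => //.
    exact: asym_supp.
  apply: contraNT Psi0 => uv; apply/eqP.
  have := @qskew_repeat _ p _ p0 _ Psi [::] v' u' p2; apply => //.
  rewrite sv'; apply: (@asym_skew _ p _ p0 _ (l + k)) => //; first by rewrite leq_addr.
  exact: asym_supp.
(* Column blocks of sizes k, l, evaluated at v: through RTT, a skew function of
   the row word. *)
pose F f : A := asym p l k (asym p k 0 f) v.
have FE f : F f = asym p k 0 (asym p l k f) v by rewrite /F asym_comm.
have F0 : F 0 = 0 by rewrite /F !linear0.
have FP c x d y : F (c *: x + d *: y) = c *: F x + d *: F y.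
  by rewrite /F !linearD !linearZ.
have vN : size v = (k + l)%N by rewrite size_cat -szJ -szJ'.
have Fsupp N f : supp N f -> N != (k + l)%N -> F f = 0.
  by move=> fN nN; apply: (@asym_supp _ p _ _ N); rewrite ?vN 1?eq_sym //; apply: asym_supp.
have Fbraid t : (t.+1 < k)%N || (k <= t)%N && (t.+1 < k + l)%N ->
    braid p t (fun u => F (monz u)) = - p *: (fun u => F (monz u)).
  move=> tk; apply/funext => w'; rewrite funE.
  rewrite -(@braid_nat _ p _ _ _ F F0 FP) monz_braid.
  have [sw'|sw'] := eqVneq (size w') (k + l)%N; last first.
    have wN' := @monz_supp w'.
    by rewrite !(Fsupp (size w')) ?scaler0 //; apply: braid_supp.
  have wN' : supp (k + l)%N (monz w') by rewrite -sw'; apply: monz_supp.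
  case/orP: tk => [tk|/andP[kt tk]].
    rewrite /F (asym_braid p0 _ wN') ?leq_addr //.
    have -> : asym p l k (- p *: asym p k 0 (monz w')) =
      - p *: asym p l k (asym p k 0 (monz w')) by rewrite linearZ.
    by [].
  rewrite !FE (asym_braid p0 _ wN') //.
  have -> : asym p k 0 (- p *: asym p l k (monz w')) =
    - p *: asym p k 0 (asym p l k (monz w')) by rewrite linearZ.
  by [].
have [u' v' su pu wu|f eB] := @swapl_eval _ p _ p0 _ (fun u => F (monz u)) (enum I) (enum I').
  have sv' : size v' = l by move/perm_size: pu; rewrite !size_cat su -szI -szI' -cI' => /addnI.
  apply/eqP; apply: contraLR wu => F0'; rewrite -leqNgt.
  apply: (@max_weight _ I I' u' v') => //; last by rewrite su -szI.
    apply: contraNT F0' => uu; apply/eqP.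
    apply: (@qskew_repeat _ p _ p0 _ (fun u => F (monz u)) [::] u' v' p2) => //.
    by move=> s /andP[_ sk]; apply: Fbraid; rewrite su -szI cI /= in sk; lia.
  apply: contraNT F0' => uv; apply/eqP.
  have := @qskew_repeat _ p _ p0 _ (fun u => F (monz u)) u' v' [::] p2; rewrite cats0; apply => //.
  by move=> s /andP[ks sk]; apply: Fbraid; rewrite su sv' -szI cI in ks sk; lia.
have key : swapr p k l 0 Psi v = swapl p k l 0 (fun u => F (monz u)) w.
  rewrite -(@swapl_nat _ p _ _ _ F F0 FP) -monz_swap /Psi /F.
  rewrite (swapr_asym_right p0); congr (asym _ _ _ _ _).
  by apply: swapr_asym_left p0 _ k l 0 (monz w).
have XY : F (monz (enum I ++ enum I')) =
    wminor (enum I) (enum J) * wminor (enum I') (enum J').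
  by rewrite FE asym_monz_cat -?szI -?szI' -?szJ -?szJ' // /wminor -szI -szI' cI cI'.
have YX : Psi (enum J' ++ enum J) =
    wminor (enum I') (enum J') * wminor (enum I) (enum J).
  by rewrite /Psi asym_monz_cat -?szI -?szI' -?szJ -?szJ' // /wminor -szI -szI' cI cI'.
exists (e - f); rewrite -XY -YX.
have -> : F (monz (enum I ++ enum I')) = p ^ (- f) *: (p ^ f *: F (monz (enum I ++ enum I'))).
  by rewrite scalerA -expfzDr // addNr expr0z scale1r.
rewrite -eB addrC expfzDr // -scalerA -eA -szJ -szJ' -szI -szI' cI cI'.
by congr (_ *: _); apply/esym.
Qed.

End MatrixWords.

(** * Quantum minors as antisymmetrized words *)

Section Laplace.
Variables (K : fieldType) (p : K) (n : nat) (V : lmodType K).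
Implicit Types (h : seq 'I_n -> V).

Definition incr k (g : 'I_k -> 'I_n) := forall i j : 'I_k, (i < j)%N -> (g i < g j)%N.

Lemma lift_incr k (t : 'I_k.+1) (g : 'I_k.+1 -> 'I_n) : incr g -> incr (g \o lift t).
Proof.
move=> gi i j ij; apply: gi; rewrite /= /bump.
by move: (nat_of_ord i) (nat_of_ord j) ij => a b; lia.
Qed.

(** In an increasing word a letter reaches the front through smaller letters only,
    so that no correction term appears. *)
Lemma cosetsum_incr k h (g : 'I_k.+1 -> 'I_n) : incr g ->
  cosetsum p k 0 h [seq g i | i <- enum 'I_k.+1] =
  \sum_(t < k.+1) (- p) ^+ t *: h (g t :: [seq g (lift t i) | i <- enum 'I_k]).
Proof.
elim: k h g => [|k IH] h g gi.
  by rewrite big_ord1 expr0 scale1r enum_ordSl /= (size0nil (size_enum_ord 0)).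
rewrite big_ord_recl expr0 scale1r enum_ordSl map_cons -map_comp.
rewrite [LHS]/= funE fun_oppE fun_scaleE cosetsum_cons.
rewrite (IH _ (g \o lift ord0)); last exact: lift_incr.
congr (_ + _); rewrite scaler_sumr -sumrN; apply: eq_bigr => t _.
have lt0 : (g ord0 < g (lift ord0 t))%N by apply: gi.
rewrite braid0E -val_eqE /= (ltn_eqF lt0) ltnNge (ltnW lt0) /=.
rewrite scale0r addr0 scale1r scalerA -scaleNr; congr (_ *: h _).
  by rewrite exprS /bump /= mulNr.
congr (_ :: _); rewrite [in RHS]enum_ordSl /= -map_comp; congr (_ :: _).
  by congr (g _); apply: val_inj.
apply: eq_map => i /=; congr (g _); apply: val_inj.
by rewrite /= /bump /=; lia.
Qed.

End Laplace.

Section PermLength.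
Local Open Scope nat_scope.

Lemma perm_lengthE k (s : 'S_k) :
  perm_length s = \sum_(i < k) \sum_(j < k) ((i < j) && (s j < s i)).
Proof.
rewrite /perm_length cardsE -sum1_card pair_big big_mkcond /=.
by apply: eq_bigr => -[i j] _; rewrite unfold_in /=; case: (_ && _).
Qed.

Lemma ltn_lift k (t : 'I_k.+1) (i j : 'I_k) : (lift t i < lift t j) = (i < j).
Proof. by rewrite /= /bump; move: (nat_of_ord i) (nat_of_ord j) => a b; lia. Qed.

(** The value t at the first place is inverted with the t smaller values behind
    it. *)
Lemma perm_length_lift k (t : 'I_k.+1) (s : 'S_k) :
  perm_length (lift_perm ord0 t s) = t + perm_length s.
Proof.
rewrite !perm_lengthE big_ord_recl; congr (_ + _).
  rewrite big_ord_recl ltnn /= add0n.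
  under eq_bigr => j _ do rewrite lift_perm_lift lift_perm_id.
  rewrite (reindex_inj (perm_inj (s := s^-1))) /=.
  under eq_bigr => j _ do rewrite permKV.
  have tk : t <= k by rewrite -ltnS.
  transitivity (\sum_(i < t) 1); last by rewrite sum_nat_const card_ord muln1.
  rewrite [RHS](big_ord_widen k (fun=> 1) tk) //.
  rewrite [RHS]big_mkcond; apply: eq_bigr => j _ /=.
  by rewrite /bump; case: (ltnP j t) => jt; lia.
apply: eq_bigr => i _; rewrite big_ord_recl /= add0n.
apply: eq_bigr => j _; rewrite !lift_perm_lift ltn_lift.
by rewrite [in LHS]ltnS.
Qed.

End PermLength.

Section Minors.
Variables (K : fieldType) (p : K) (m n : nat) (A : algType K) (z : 'I_m -> 'I_n -> A).

(** The minor of [qminor], with rows and columns listed by functions, so that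
    rows and columns can be deleted by [lift]. *)
Definition qdet k (f : 'I_k -> 'I_m) (g : 'I_k -> 'I_n) : A :=
  \sum_(s : 'S_k) (- p) ^+ perm_length s *: \prod_(i <- enum 'I_k) z (f i) (g (s i)).

Lemma qdet_row k (f : 'I_k.+1 -> 'I_m) (g : 'I_k.+1 -> 'I_n) :
  qdet f g = \sum_(t < k.+1) (- p) ^+ t *:
    (z (f ord0) (g t) * qdet (f \o lift ord0) (g \o lift t)).
Proof.
pose F (ts : 'I_k.+1 * 'S_k) := lift_perm ord0 ts.1 ts.2.
have Fbij : bijective F.
  apply: inj_card_bij => [[t s] [t' s'] eqF|].
    have /= := congr1 (fun r : 'S_k.+1 => r ord0) eqF; rewrite /F !lift_perm_id /= => tt.
    congr (_, _) => //; apply/permP => i.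
    have := congr1 (fun r : 'S_k.+1 => r (lift ord0 i)) eqF.
    by rewrite /F !lift_perm_lift /= -tt; apply: lift_inj.
  by rewrite card_prod card_ord !card_Sn factS.
rewrite /qdet (reindex F) /=; last exact: onW_bij.
rewrite -(pair_bigA _ (fun t s => (- p) ^+ perm_length (F (t, s)) *:
  \prod_(i <- enum 'I_k.+1) z (f i) (g (F (t, s) i)))) /=.
apply: eq_bigr => t _; rewrite mulr_sumr scaler_sumr; apply: eq_bigr => s _.
rewrite perm_length_lift exprD -scalerA -scalerAr enum_ordSl big_cons big_map.
rewrite lift_perm_id; congr (_ *: (_ *: (_ * _))).
by apply: eq_bigr => i _; rewrite lift_perm_lift.
Qed.

Lemma asym_monz k (f : 'I_k -> 'I_m) (g : 'I_k -> 'I_n) : incr g ->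
  asym p k 0 (monz z [seq f i | i <- enum 'I_k]) [seq g i | i <- enum 'I_k] = qdet f g.
Proof.
elim: k f g => [|k IH] f g gi.
  rewrite /qdet (size0nil (size_enum_ord 0)) /=.
  rewrite (big_pred1 1%g) => [|s]; last by apply/esym/eqP/permP => -[].
  rewrite big_nil perm_lengthE big_ord0 expr0 scale1r //.
rewrite [LHS]/= cosetsum_incr // qdet_row; apply: eq_bigr => t _; congr (_ *: _).
rewrite asym_cons -(IH _ (g \o lift t)); last exact: lift_incr.
rewrite (@asym_nat _ p _ _ _ (fun x => z (f ord0) (g t) * x)) ?mulr0 //; last first.
  by move=> c x d y; rewrite mulrDr !scalerAr.
congr (asym _ _ _ _ _); apply/funext => r.
by rewrite enum_ordSl /= -map_comp.
Qed.

End Minors.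

Lemma enum_set_incr k (J : {set 'I_k}) : incr (@enum_val _ (mem J)).
Proof.
move=> i j ij; have x0 := enum_val i.
rewrite !(enum_val_nth x0); apply: (@sorted_ltn_nth _ (fun a b : 'I_k => (a < b)%N)).
- by move=> a b c; apply: ltn_trans.
- rewrite {1}/enum_mem; apply: sorted_filter; first by move=> a b c; apply: ltn_trans.
  have := iota_ltn_sorted 0 k; rewrite -val_enum_ord sorted_map.
  by rewrite enumT.
- by rewrite inE -cardE.
- by rewrite inE -cardE.
- exact: ij.
Qed.

Lemma map_enum_val k l (J : {set 'I_k}) (e : l = #|J|) :
  [seq enum_val (cast_ord e i) | i <- enum 'I_l] = enum J.
Proof.
subst l; rewrite -[RHS](map_tnth_enum (enum_tuple (mem J))).
by apply: eq_map => i; rewrite cast_ord_id (tnth_nth (enum_default i)).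
Qed.

Lemma qminor_wminor (K : fieldType) (q : K) m n (I : {set 'I_m}) (J : {set 'I_n}) :
  #|I| = #|J| -> qminor q I J = wminor (q ^+ 2) (@Z K q m n) (enum I) (enum J).
Proof.
move=> cIJ; rewrite /wminor -cardE cIJ.
have eJ := map_enum_val (erefl #|J|).
rewrite -(map_enum_val (esym cIJ)) -eJ.
rewrite (eq_map (g := enum_val)) => [|i]; last by rewrite cast_ord_id.
rewrite asym_monz; last exact: enum_set_incr.
rewrite /qminor; apply: eq_bigr => s _; congr (_ *: _).
by rewrite -(map_enum_val (esym cIJ)) zip_map big_map.
Qed.

(** The hypothesis q^4 <> -1 says that the eigenvalues q^-2 and -q^2 of the
    braidings differ. *)
Lemma qminor_qcommute (K : fieldType) (q : K) m n (I I' : {set 'I_m}) (J J' : {set 'I_n}) :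
    q != 0 -> q ^+ 4 != -1 -> #|I| = #|J| -> #|I'| = #|J'| ->
    (forall x y, x \in J :\: J' -> y \in J' :\: J -> (x < y)%N) ->
    (forall x y, x \in I :\: I' -> y \in I' :\: I -> (y < x)%N) ->
  qcommute q (qminor q I J) (qminor q I' J').
Proof.
move=> q0 q4 cI cI' ltJ ltI.
have p0 : q ^+ 2 != 0 by rewrite expf_neq0.
have p4 : (q ^+ 2) ^+ 2 != -1 by rewrite -exprM.
rewrite !qminor_wminor //.
have [] := @wminor_qcommute K (q ^+ 2) m n (Oq q m n) (@Z K q m n) p0 _ _ _ _
  I I' J J' p4 cI cI' ltJ ltI.
- exact: Z_row.
- exact: Z_col.
- exact: Z_anti.
- by move=> i s j t ii jj; rewrite Z_diag.
by move=> e eX; exists e; apply: etrans eX _; rewrite -exprz_exp.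
Qed.

(** * Broken lines *)

Section Intervals.
Local Open Scope nat_scope.
Variable k : nat.
Implicit Types (a b c : 'I_k) (I : {set 'I_k}).

Definition seg (a b : nat) : {set 'I_k} := [set i : 'I_k | a <= i <= b].

Lemma card_seg (a b : nat) : b < k -> #|seg a b| = b.+1 - a.
Proof.
move=> bk; rewrite cardsE -sum1_card.
rewrite -(big_mkord (fun i => (a <= i) && (i <= b)) (fun=> 1)).
rewrite -(@big_nat_widen _ _ _ 0 b.+1 k (fun i => a <= i)) ?ltn_ord //.
rewrite -(@big_nat_widenl _ _ _ a 0 b.+1 xpredT (fun=> 1)) //.
by rewrite sum_nat_const_nat muln1.
Qed.

Lemma consecutive_seg (a b : nat) : consecutive (seg a b).
Proof.
apply/forall_inP => i; rewrite inE => /andP[ai _].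
apply/forall_inP => j; rewrite inE => /andP[_ jb].
apply/forallP => l; apply/implyP => /andP[il lj].
by rewrite inE (leq_trans ai il) (leq_trans lj jb).
Qed.

Lemma consecutiveP I x : consecutive I -> x \in I ->
  exists a b, [/\ a \in I, b \in I, a <= b & I = seg a b].
Proof.
move=> cI xI.
case: (arg_minnP (fun i : 'I_k => i : nat) xI) => a aI amin.
case: (arg_maxnP (fun i : 'I_k => i : nat) xI) => b bI bmax.
exists a, b; split=> //; first exact: amin.
apply/setP => i; rewrite inE; apply/idP/idP => [iI|ab].
  by apply/andP; split; [apply: amin | apply: bmax].
by move/forall_inP: cI => /(_ a aI) /forall_inP /(_ b bI) /forallP /(_ i) /implyP; apply.
Qed.

End Intervals.

Section BrokenLine.
Local Open Scope nat_scope.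
Variables (m n : nat) (L : {set 'I_m * 'I_n}).
Hypothesis hL : broken_line L.
Implicit Types (w x y : 'I_m * 'I_n).

Lemma path_comparable x s y y' : path (@line_step m n) x s ->
    y \in x :: s -> y' \in x :: s ->
  (y.1 <= y'.1) && (y'.2 <= y.2) || (y'.1 <= y.1) && (y.2 <= y'.2).
Proof.
pose R w w' := (w.1 <= w'.1) && (w'.2 <= w.2) : bool.
rewrite -/(R y y') -/(R y' y) => /(@sub_path _ _ R) pxs.
have {pxs} : path R x s.
  apply: pxs => w w' /orP[|] /andP[/eqP e1 /eqP e2]; apply/andP.
    by rewrite e1 e2.
  by rewrite e1 e2.
have Rtr : transitive R.
  move=> w2 w1 w3 /andP[a b] /andP[c d]; apply/andP; split.
    exact: leq_trans c.
  exact: leq_trans b.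
have Rrefl w : R w w by rewrite /R !leqnn.
elim: s x => [|z s IH] x /= pxs.
  by rewrite !inE => /eqP -> /eqP ->; rewrite Rrefl.
have := order_path_min Rtr (pxs : path R x (z :: s)) => /allP xmin.
rewrite inE => /orP[/eqP ->|yzs].
  by rewrite inE => /orP[/eqP ->|/xmin -> //]; rewrite Rrefl.
rewrite inE => /orP[/eqP ->|]; first by rewrite (xmin _ yzs) orbT.
by move: yzs; apply: IH; case/andP: pxs.
Qed.

Lemma line_antichain y y' : y \in L -> y' \in L -> y.1 < y'.1 -> y.2 < y'.2 -> False.
Proof.
case: hL => x [s [_ pxs _ ->]]; rewrite !inE => yL y'L.
have := path_comparable pxs; move/(_ y y'); rewrite !inE => /(_ yL y'L).
by case: y y' {yL y'L} => [i j] [i' j'] /=; lia.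
Qed.

(** Each step of the line lowers the column number minus the row number by exactly
    one, so this difference takes every value between those of the ends. *)
Lemma path_diagonal x s w : path (@line_step m n) x s ->
    x.1 + w.2 <= x.2 + w.1 -> (last x s).2 + w.1 <= (last x s).1 + w.2 ->
  exists2 y : 'I_m * 'I_n, y \in x :: s & y.1 + w.2 = y.2 + w.1.
Proof.
elim: s x => [|z s IH] x /=.
  by move=> _ le1 le2; exists x; rewrite ?mem_head //; apply/eqP; rewrite eqn_leq le1.
move=> /andP[xz pzs] le1 le2.
have [e|ne] := eqVneq (x.1 + w.2) (x.2 + w.1); first by exists x; rewrite ?mem_head.
have [|y yzs ey] := IH z pzs _ le2; last by exists y; rewrite // inE yzs orbT.
case/orP: xz => /andP[/eqP e1 /eqP e2].
  by rewrite e1; lia.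
by rewrite e2; lia.
Qed.

Lemma line_meets_diagonal w : exists2 y : 'I_m * 'I_n, y \in L & y.1 + w.2 = y.2 + w.1.
Proof.
case: hL => x [s [[x1 x2] pxs [e1 e2] eL]].
have [||y yL ey] := @path_diagonal x s w pxs; last by exists y; rewrite // eL inE.
  by rewrite x1 add0n; have := ltn_ord w.2; lia.
by rewrite e2 add0n; have := ltn_ord w.1; lia.
Qed.

Lemma diag_shiftP y w : y.1 <= w.1 -> y.1 + w.2 = y.2 + w.1 -> diag_shift y (w.1 - y.1) w.
Proof.
case: y w => [i j] [i' j'] /= ii e; rewrite /diag_shift /= subnKC // eqxx /=.
by apply/eqP; lia.
Qed.

Lemma aboveP w : w \in above L -> exists2 y : 'I_m * 'I_n, y \in L & w.1 < y.1 /\ w.2 < y.2.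
Proof.
rewrite inE => /andP[_ /existsP[t /andP[t0 /existsP[y /andP[yL /andP[/eqP e1 /eqP e2]]]]]].
by exists y => //; rewrite e1 e2; lia.
Qed.

Lemma not_aboveP w : w \notin above L ->
  exists y : 'I_m * 'I_n, [/\ y \in L, y.1 <= w.1 & y.1 + w.2 = y.2 + w.1].
Proof.
move=> wA; have [wL|wL] := boolP (w \in L); first by exists w; rewrite wL addnC.
have [y yL ey] := line_meets_diagonal w; exists y; split=> //.
rewrite leqNgt; apply: contra wA => wy.
have ty : y.1 - w.1 < m by have := ltn_ord y.1; lia.
rewrite inE wL /=; apply/existsP; exists (Ordinal ty) => /=.
rewrite subn_gt0 wy /=; apply/existsP; exists y; rewrite yL /=.
by apply: diag_shiftP; [apply: ltnW | lia].
Qed.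

Lemma in_below w y : y \in L -> y.1 <= w.1 -> y.1 + w.2 = y.2 + w.1 -> w \in below L :|: L.
Proof.
move=> yL yw ey; rewrite inE; have [wL|wL] := boolP (w \in L); first by rewrite orbT.
rewrite orbF inE wL /=.
have [e|ne] := eqVneq (y.1 : nat) w.1.
  case/negP: wL; suff -> : w = y by [].
  by case: w y e ey {yL yw} => [i j] [i' j'] /= e ee; congr (_, _); apply/val_inj => /=; lia.
have ty : w.1 - y.1 < m by have := ltn_ord w.1; lia.
apply/existsP; exists (Ordinal ty) => /=.
rewrite subn_gt0 ltn_neqAle ne yw /=; apply/existsP; exists y; rewrite yL /=.
exact: diag_shiftP.
Qed.

Lemma belowP w : w \in below L :|: L ->
  exists y : 'I_m * 'I_n, [/\ y \in L, y.1 <= w.1 & y.1 + w.2 = y.2 + w.1].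
Proof.
rewrite inE => /orP[|wL]; last by exists w; rewrite wL addnC.
rewrite inE => /andP[_ /existsP[t /andP[t0 /existsP[y /andP[yL /andP[/eqP e1 /eqP e2]]]]]].
by exists y; split=> //; lia.
Qed.

(** If the point of L on the diagonal of w came strictly after w, it would lie
    strictly southeast of y. *)
Lemma below_SE y w : y \in L -> y.1 <= w.1 -> y.2 <= w.2 -> w \in below L :|: L.
Proof.
move=> yL y1 y2; have [y' y'L e] := line_meets_diagonal w.
have [le|gt] := leqP y'.1 w.1; first exact: in_below e.
by case: (@line_antichain y y'); lia.
Qed.

(** * The family attached to a broken line *)

(** The two kinds of squares [a,b] x [c,d] that index V_L; the squares starting
    above L touch the lower or the right side because they are maximal. *)
Definition anchored (a b : 'I_m) (c d : 'I_n) : Prop :=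
  (a, c) \in L \/
  (exists2 y : 'I_m * 'I_n, y \in L & a < y.1 /\ c < y.2) /\ (b.+1 = m \/ d.+1 = n).

Lemma biggestP x (P : pred (index_pair m n)) : P ([set x.1], [set x.2]) ->
  P (biggest x P) /\ forall Y, P Y -> #|Y.1| <= #|(biggest x P).1|.
Proof. by move=> P0; rewrite /biggest; case: arg_maxnP. Qed.

Lemma seg_solid (a b c d : nat) : b < m -> d < n ->
  b.+1 - a = d.+1 - c -> solid (seg m a b, seg n c d).
Proof. by move=> bm dn e; rewrite /solid /= !card_seg // e eqxx !consecutive_seg. Qed.

Lemma set1_seg k (a : 'I_k) : [set a] = seg k a a.
Proof. by apply/setP => i; rewrite !inE -eqn_leq eq_sym. Qed.

Lemma solidP (X : index_pair m n) x : solid X -> x.1 \in X.1 -> x.2 \in X.2 ->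
  exists (a b : 'I_m) (c d : 'I_n),
    [/\ X = (seg m a b, seg n c d), a <= b, c <= d & b + c = d + a].
Proof.
case: X => I J; rewrite /solid /= => /and3P[/eqP cIJ cI cJ] xI xJ.
have [a [b [aI bI ab eI]]] := consecutiveP cI xI.
have [c [d [cJ' dJ cd eJ]]] := consecutiveP cJ xJ.
exists a, b, c, d; split=> //; first by rewrite eI eJ.
by move: cIJ; rewrite eI eJ !card_seg ?ltn_ord //; lia.
Qed.

(** A square above L that does not touch the sides could be enlarged.  A square
    ending at x outside the points above L competes with the square that starts
    at the point of L on the diagonal of x: that square lies in the allowed
    region, and by [line_antichain] no square in this region starts earlier. *)
Lemma Vindex_spec x : exists (a b : 'I_m) (c d : 'I_n),
  [/\ Vindex L x = (seg m a b, seg n c d), a <= b, c <= d, b + c = d + a & anchored a b c d].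
Proof.
rewrite /Vindex; case: ifPn => xA.
  set P := (Y in biggest x Y); have [|] := @biggestP x P.
    rewrite /P /= !set1_seg seg_solid ?ltn_ord //; last by rewrite !subSnn.
    rewrite /has_upper_left /= !inE !leqnn /=.
    by apply/andP; split; apply/forall_inP => i; rewrite inE => /andP[].
  move: (biggest x P) => X /= /andP[sX /and4P[xI xJ minI minJ]] Xmax.
  have [a [b [c [d [eX ab cd e]]]]] := solidP sX xI xJ.
  exists a, b, c, d; split=> //; right.
  move: xI xJ minI minJ Xmax; rewrite eX /= !inE.
  move=> xI xJ /forall_inP minI /forall_inP minJ Xmax.
  have ea : a = x.1 :> nat.
    by have := minI a; rewrite inE leqnn ab => /(_ isT); lia.
  have ec : c = x.2 :> nat.
    by have := minJ c; rewrite inE leqnn cd => /(_ isT); lia.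
  split; first by have [y yL yx] := aboveP xA; exists y; rewrite // ea ec.
  have [bm|bm] := eqVneq b.+1 m; first by left.
  have [dn|dn] := eqVneq d.+1 n; first by right.
  have bm1 : b.+1 < m by rewrite ltn_neqAle bm ltn_ord.
  have dn1 : d.+1 < n by rewrite ltn_neqAle dn ltn_ord.
  have := Xmax (seg m a b.+1, seg n c d.+1).
  rewrite /P /= !card_seg ?ltn_ord // seg_solid //; last by lia.
  move=> /(_ _) /= H; suff /H : has_upper_left x (seg m a b.+1, seg n c d.+1) by lia.
  rewrite /has_upper_left /= !inE ea ec !leqnn -ea -ec !leqW //=.
  by apply/andP; split; apply/forall_inP => i; rewrite inE => /andP[].
have [y0 [y0L y0x ey0]] := not_aboveP xA.
set P := (Y in biggest x Y); have [|] := @biggestP x P.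
  rewrite /P /= !set1_seg seg_solid ?ltn_ord //; last by rewrite !subSnn.
  rewrite andTb; apply/andP; split.
    rewrite /has_bottom_right /= !inE !leqnn /=.
    by apply/andP; split; apply/forall_inP => i; rewrite inE => /andP[].
  rewrite -!set1_seg; apply/subsetP => -[i j]; rewrite !inE /= => /andP[/eqP -> /eqP ->].
  by have := in_below y0L y0x ey0; rewrite !inE -surjective_pairing.
move: (biggest x P) => X /= /and3P[sX /and4P[xI xJ maxI maxJ] /subsetP inX] Xmax.
have [a [b [c [d [eX ab cd e]]]]] := solidP sX xI xJ.
exists a, b, c, d; split=> //; left.
move: xI xJ maxI maxJ inX Xmax; rewrite eX /= !inE.
move=> xI xJ /forall_inP maxI /forall_inP maxJ inX Xmax.
have eb : b = x.1 :> nat.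
  by have := maxI b; rewrite inE leqnn ab => /(_ isT); lia.
have ed : d = x.2 :> nat.
  by have := maxJ d; rewrite inE leqnn cd => /(_ isT); lia.
have y0x2 : y0.2 <= x.2 by lia.
have ay : a <= y0.1.
  have := Xmax (seg m y0.1 b, seg n y0.2 d).
  rewrite /P /= !card_seg ?ltn_ord // seg_solid ?ltn_ord //; last by lia.
  move=> /(_ _) /= H; suff /H : has_bottom_right x (seg m y0.1 b, seg n y0.2 d)
      && inside (below L :|: L) (seg m y0.1 b, seg n y0.2 d) by lia.
  apply/andP; split.
    rewrite /has_bottom_right /= !inE eb ed y0x y0x2 !leqnn /=.
    by apply/andP; split; apply/forall_inP => i; rewrite inE => /andP[].
  apply/subsetP => w; rewrite !inE /= => /andP[/andP[yw1 _] /andP[yw2 _]].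
  by have := below_SE y0L yw1 yw2; rewrite !inE.
have [|y [yL ya ey]] := @belowP (a, c).
  by apply: inX; rewrite !inE /= !leqnn ab cd.
suff -> : (a, c) = y by [].
have yy : y.1 = y0.1 :> nat.
  apply/eqP; rewrite eqn_leq (leq_trans ya ay) /= leqNgt; apply/negP => lt.
  by apply: (line_antichain yL y0L lt); move: ey ey0 => /=; lia.
move: ya ey ey0; case: y yL yy => [y1 y2] yL /= yy ya ey ey0.
by congr (_, _); apply: val_inj => /=; lia.
Qed.

End BrokenLine.

(** Two intervals are nested or one is shifted with respect to the other; only a
    shift in the wrong direction breaks the order of the differences. *)
Lemma seg_diff_lt k (a b a' b' : nat) : ~~ ((a' < a) && (b' < b))%N ->
  forall i j, i \in seg k a b :\: seg k a' b' -> j \in seg k a' b' :\: seg k a b ->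
  (i < j)%N.
Proof. by move=> h i j; rewrite !inE; lia. Qed.

Lemma anchored_not_NW_SE m n (L : {set 'I_m * 'I_n}) a b c d a' b' c' d' : broken_line L ->
  anchored L a b c d -> anchored L a' b' c' d' ->
  ~~ [&& a < a', b < b', c < c' & d < d']%N.
Proof.
move=> hL xL yL; apply/negP => /and4P[aa bb cc dd].
have [b'm d'n] := (ltn_ord b', ltn_ord d').
case: xL => [xL|[_ xL]]; last by lia.
case: yL => [yL|[[w wL [aw cw]] _]]; first exact: (line_antichain hL xL yL).
by apply: (line_antichain hL xL wL) => /=; lia.
Qed.

Lemma qcommute_sym (K : fieldType) (q : K) (A : algType K) (x y : A) : q != 0 ->
  qcommute q x y -> qcommute q y x.
Proof.
move=> q0 [e exy]; exists (- e).
by rewrite exy scalerA -expfzDr // mulrN addNr expr0z scale1r.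
Qed.

Lemma qvar_neq0 : qvar != 0.
Proof. by rewrite /qvar tofrac_eq0 polyX_eq0. Qed.

Lemma qvar4_neqN1 : qvar ^+ 4 != -1.
Proof.
rewrite -subr_eq0 opprK /qvar -tofracXn -tofrac1 -tofracD tofrac_eq0.
by rewrite -size_poly_eq0 -polyC1 size_XnaddC.
Qed.

Theorem proposition6p5 (m n : nat) (hm : (0 < m)%N) (hn : (0 < n)%N)
    (L : {set 'I_m * 'I_n}) (hL : broken_line L) (x y : 'I_m * 'I_n) :
  qcommute qvar (Vfamily qvar L x) (Vfamily qvar L y).
Proof.
rewrite /Vfamily.
have [a [b [c [d [-> ab cd e xL]]]]] := Vindex_spec hL x.
have [a' [b' [c' [d' [-> ab' cd' e' yL]]]]] := Vindex_spec hL y.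
have nxy := anchored_not_NW_SE hL xL yL; have nyx := anchored_not_NW_SE hL yL xL.
have cX : #|seg m a b| = #|seg n c d| by rewrite !card_seg //; lia.
have cY : #|seg m a' b'| = #|seg n c' d'| by rewrite !card_seg //; lia.
have [/andP[h1 h2]|] := boolP (~~ ((c' < c) && (d' < d))%N && ~~ ((a < a') && (b < b'))%N).
  apply: qminor_qcommute => //; [exact: qvar_neq0|exact: qvar4_neqN1|exact: seg_diff_lt|].
  by move=> i j iI jI; apply: (seg_diff_lt h2).
(* Otherwise the columns or the rows are shifted the wrong way; as neither square
   is strictly northwest of the other, the pair in the other order is good. *)
move=> h; apply: qcommute_sym; first exact: qvar_neq0.
apply: qminor_qcommute => //; [exact: qvar_neq0|exact: qvar4_neqN1| |].
  by apply: seg_diff_lt; lia.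
by move=> i j iI jI; apply: (@seg_diff_lt m a b a' b') => //; lia.
Qed.
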